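(* Let $\mathbb{F}$ be a finite field and let $A\in \mathbb{F}^{n\times n}$ be a generic matrix, and suppose a Frobenius normal form of $A$ is given. One can preprocess $A$ in $\widetilde{O}(n^2)$ time so that the following queries are supported: given $S,T\subseteq \{1,\ldots,n\}$ and an integer $h\in [1,n]$, compute the $S\times T$ submatrices of the matrix powers $A^1,\ldots,A^h$. The query time is $\widetilde{O}(n^{\omega(s,1-\alpha,t)+\alpha})$, where $|S|=\lfloor n^s\rfloor$, $|T|=\lfloor n^t\rfloor$ and $h=\lfloor n^\alpha\rfloor$.
   Context: A matrix $A\in\mathbb{F}^{n\times n}$ is called generic if its characteristic polynomial $p_A(t)=\det(tI-A)$ equals its minimal polynomial. For generic $A$ with $p_A(t)=t^n+c_{n-1}t^{n-1}+\dots+c_0$, a Frobenius normal form (FNF) of $A$ is a factorization $A=U\cdot C\cdot U^{-1}$ with $U\in\mathbb{F}^{n\times n}$ invertible and $C$ the companion matrix of $p_A$ (the matrix with ones on the subdiagonal, last column $(-c_0,\ldots,-c_{n-1})^T$, and zeros elsewhere); ''given'' means $U$, $C$ and $U^{-1}$ are given explicitly. Time is measured in field operations. $\omega(a,b,c)$ denotes the exponent such that an $n^a\times n^b$ matrix can be multiplied by an $n^b\times n^c$ matrix in $O(n^{\omega(a,b,c)})$ time. $\widetilde{O}$ hides polylogarithmic factors in $n$. *)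

(* Defs.v *)
From HB Require Import structures.
From mathcomp Require Import all_boot all_order all_algebra all_field.
From mathcomp Require Import all_classical all_reals all_analysis.

Set Implicit Arguments.
Unset Strict Implicit.
Unset Printing Implicit Defensive.

Import Order.TTheory GRing.Theory Num.Theory.

Local Open Scope ring_scope.

(* Straight-line programs over a field [F], with inputs named by [I] and outputs
   named by [O].  The running time is the number of field operations; reading an
   input, a constant or an earlier result, and naming an output, is free.  The
   programs themselves may depend on sizes and index sets, never on the values
   of the inputs. *)

Inductive operand (F I : Type) : Type :=
| Input of I
| Const of F
| Tmp of nat. (* result of the instruction with this (0-based) position *)

Inductive arith : Type := OpAdd | OpSub | OpMul | OpDiv.

Record slp (F I O : Type) : Type := Slp {
  slp_code : seq (arith * operand F I * operand F I);
  slp_out : O -> operand F I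
}.

Definition slp_cost (F I O : Type) (P : slp F I O) : nat := size (slp_code P).

Section Eval.
Variables (F : fieldType) (I O : Type).

Definition operand_eval (x : I -> F) (mem : seq F) (o : operand F I) : F :=
  match o with
  | Input i => x i
  | Const c => c
  | Tmp k => nth 0 mem k
  end.

(* Division is total, with [a / 0 = 0].  Over a finite field with q elements
   this inverse is the power q - 2, so the convention adds no expressive power. *)
Definition arith_eval (op : arith) (a b : F) : F :=
  match op with
  | OpAdd => a + b
  | OpSub => a - b
  | OpMul => a * b
  | OpDiv => a / b
  end.

Definition slp_step (x : I -> F) (mem : seq F)
    (ins : arith * operand F I * operand F I) : seq F :=
  let: (op, a, b) := ins in
  rcons mem (arith_eval op (operand_eval x mem a) (operand_eval x mem b)).

Definition slp_eval (P : slp F I O) (x : I -> F) (o : O) : F :=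
  operand_eval x (foldl (slp_step x) [::] (slp_code P)) (slp_out P o).

End Eval.

Definition mm_input (F : Type) (p q r : nat) (A : 'M[F]_(p, q)) (B : 'M[F]_(q, r))
    (e : 'I_p * 'I_q + 'I_q * 'I_r) : F :=
  match e with
  | inl ij => A ij.1 ij.2
  | inr ij => B ij.1 ij.2
  end.

Definition computes_mm (F : fieldType) (p q r : nat)
    (P : slp F ('I_p * 'I_q + 'I_q * 'I_r) ('I_p * 'I_r)) : Prop :=
  forall (A : 'M[F]_(p, q)) (B : 'M[F]_(q, r)) (i : 'I_p) (j : 'I_r),
    slp_eval P (mm_input A B) (i, j) = (A *m B) i j.

(* The integer part of n^a. *)
Definition floor_pow (R : realType) (n : nat) (a : R) : nat :=
  Num.truncn (n%:R `^ a).

(* [omega a b c] is an exponent such that an n^a x n^b matrix and an n^b x n^c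
   matrix over [F] can be multiplied in O(n^(omega a b c)) field operations, the
   hidden constant [K] being allowed to depend on a, b, c.  Optimality of [omega]
   is not required, since an infimum of exponents need not be attained. *)
Definition mm_exponent (R : realType) (F : fieldType) (omega : R -> R -> R -> R)
    : Prop :=
  forall a b c : R, 0 <= a -> 0 <= b -> 0 <= c ->
  exists K : R, forall n : nat, (0 < n)%N ->
  exists P : slp F ('I_(floor_pow n a) * 'I_(floor_pow n b)
                    + 'I_(floor_pow n b) * 'I_(floor_pow n c))
                   ('I_(floor_pow n a) * 'I_(floor_pow n c)),
    computes_mm P /\ (slp_cost P)%:R <= K * n%:R `^ (omega a b c).

(* The bound K n^x polylog(n); the summand 1 keeps it meaningful at n = 1. *)
Definition soft_bound (R : realType) (K : R) (k : nat) (x : R) (n : nat) : R :=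
  K * n%:R `^ x * (1 + ln n%:R) ^+ k.

Definition generic (F : fieldType) (n : nat) (A : 'M[F]_n.+1) : Prop :=
  char_poly A = mxminpoly A.

(* The library's [companionmx] is the transpose of this one. *)
Definition companion (F : fieldType) (n : nat) (p : {poly F}) : 'M[F]_n.+1 :=
  \matrix_(i, j) if j == ord_max then - p`_i else (i == j.+1 :> nat)%:R.

Definition frobenius_form (F : fieldType) (n : nat) (A U C : 'M[F]_n.+1) : Prop :=
  [/\ U \in unitmx, C = companion n (char_poly A) & A = U *m C *m invmx U].

Inductive fnf_entry (n : nat) : Type :=
| EntryA of 'I_n & 'I_n
| EntryU of 'I_n & 'I_n
| EntryC of 'I_n & 'I_n
| EntryUinv of 'I_n & 'I_n.

Definition fnf_input (F : fieldType) (n : nat) (A U C : 'M[F]_n)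
    (e : fnf_entry n) : F :=
  match e with
  | EntryA i j => A i j
  | EntryU i j => U i j
  | EntryC i j => C i j
  | EntryUinv i j => invmx U i j
  end.

(* Main.v *)
(* A Frobenius form A = U C U^-1 turns powers of A into Hankel-like sums: with
   w(i, k) = (U C^k e_0)_i one has C^l e_0 = e_l for l < n, hence
   (A^k)_(i, j) = sum_(l < n) w(i, k + l) (U^-1)_(l, j).  Each row w(i, .) is a
   linear recurrence whose coefficients are in the last column of C, so it is
   extended from n to 2n terms by two products of power series; this is the
   preprocessing.  A query is a family of middle products.  Cutting the sums into
   about n / h blocks of length h and multiplying polynomials of length 2h by a
   bilinear algorithm, i.e. linear maps before and after O~(h) independent
   products, replaces each product of scalars by a product of an |S| x n/h matrix
   and an n/h x |T| matrix; the linear maps are absorbed because a program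
   multiplying p x q by q x r matrices needs at least pq/2, qr/2 and pr steps.

   Over an arbitrary field the bilinear algorithm is that of Schoenhage and
   Strassen, with a radix r, 2 or 3, that is invertible in F: a polynomial of
   length r^(a + b) is seen as a polynomial of length r^b in y = x^(r^a), whose
   coefficients are multiplied in F[x]/(1 + x^L + ... + x^((r - 1) L)) with
   L = r^(a + 1), where x is a root of unity of order r L. *)

Require Import Defs.
From HB Require Import structures.
From mathcomp Require Import all_boot all_order all_algebra all_field.
From mathcomp Require Import all_classical all_reals all_analysis.
From mathcomp Require Import zify ring lra.

Set Implicit Arguments.
Unset Strict Implicit.
Unset Printing Implicit Defensive.

Import Order.TTheory GRing.Theory Num.Theory.

Local Open Scope ring_scope.

(** * Straight-line programs as a cost calculus *)

Section Calculus.
Variable F : fieldType.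

(** Index types may be infinite: only instructions are counted, so sequences are functions on [nat],
    and reindexing or padding by zeros is free. *)
Definition computable (I J : Type) (f : (I -> F) -> J -> F) (c : nat) : Prop :=
  exists2 P : slp F I J, (slp_cost P <= c)%N & forall x, slp_eval P x =1 f x.

Definition operand_subst (I J : Type) (s : J -> operand F I) (n : nat)
    (o : operand F J) : operand F I :=
  match o with
  | Input j => s j
  | Const c => Const I c
  | Tmp k => Tmp F I (n + k)
  end.

Definition instr_subst (I J : Type) (s : J -> operand F I) (n : nat)
    (ins : arith * operand F J * operand F J) :=
  let: (op, a, b) := ins in (op, operand_subst s n a, operand_subst s n b).

(** The hypothesis ranges over all extensions [mem2] of the memory because an input of the appended
    program may be read at any later step. *)
Lemma operand_substP (I J : Type) (x : I -> F) (y : J -> F) s mem mem' o :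
    (forall j mem2, operand_eval x (mem ++ mem2) (s j) = y j) ->
  operand_eval x (mem ++ mem') (operand_subst s (size mem) o)
  = operand_eval y mem' o.
Proof.
move=> sP; case: o => [j|c|k] //=.
by rewrite nth_cat ltnNge leq_addr /= addKn.
Qed.

Lemma foldl_subst (I J : Type) (x : I -> F) (y : J -> F) s mem mem' code :
    (forall j mem2, operand_eval x (mem ++ mem2) (s j) = y j) ->
  foldl (slp_step x) (mem ++ mem') (map (instr_subst s (size mem)) code)
  = mem ++ foldl (slp_step y) mem' code.
Proof.
move=> sP; elim: code mem' => [//|[[op a] b] code IH] mem' /=.
by rewrite !(operand_substP _ _ sP) rcons_cat IH.
Qed.

Lemma size_foldl_step (I : Type) (x : I -> F) mem code :
  size (foldl (slp_step x) mem code) = (size mem + size code)%N.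
Proof.
elim: code mem => [|[[op a] b] code IH] mem /=; first by rewrite addn0.
by rewrite IH size_rcons addSnnS.
Qed.

(* An output naming a result that does not exist evaluates to 0; it has to be
   replaced by the constant before more code is appended. *)
Definition operand_clip (I : Type) (n : nat) (o : operand F I) : operand F I :=
  if o is Tmp k then if (k < n)%N then o else Const I 0 else o.

Lemma operand_clipP (I : Type) (x : I -> F) mem mem' o :
  operand_eval x (mem ++ mem') (operand_clip (size mem) o)
  = operand_eval x mem o.
Proof.
case: o => [j|c|k] //=; case: ltnP => kn /=; first by rewrite nth_cat kn.
by rewrite nth_default.
Qed.

Definition select (I J : Type) (x : I -> F) (y : J -> F) (e : I + J) : F :=
  match e with inl i => x i | inr j => y j end.

Lemma computable_ext (I J : Type) (f g : (I -> F) -> J -> F) c c' :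
  computable f c -> (c <= c')%N -> (forall x, f x =1 g x) -> computable g c'.
Proof.
move=> [P cP eP] cc fg; exists P; first exact: leq_trans cP cc.
by move=> x j; rewrite eP fg.
Qed.

Lemma computable_leq (I J : Type) (f : (I -> F) -> J -> F) c c' :
  computable f c -> (c <= c')%N -> computable f c'.
Proof. by move=> fc cc; apply: computable_ext fc cc _. Qed.


(** Concatenation of two programs, the second of which still sees the inputs of the first; [s] says
    where each of its own inputs comes from. *)
Lemma computable_let (I J L O : Type) (f : (I -> F) -> J -> F)
    (g : (L -> F) -> O -> F) (s : L -> I + J) c1 c2 :
    computable f c1 -> computable g c2 ->
  computable (fun x => g (fun l => select x (f x) (s l))) (c1 + c2).
Proof.
move=> [P cP eP] [Q cQ eQ].
pose n := size (slp_code P).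
pose s' l : operand F I :=
  match s l with inl i => Input F i | inr j => operand_clip n (slp_out P j) end.
exists (Slp (slp_code P ++ map (instr_subst s' n) (slp_code Q))
            (fun o => operand_subst s' n (slp_out Q o))).
  by rewrite /slp_cost /= size_cat size_map leq_add.
move=> x o; rewrite -eQ /slp_eval /= foldl_cat.
set mem := foldl _ _ (slp_code P).
have en : n = size mem by rewrite /mem size_foldl_step.
have sP l mem2 : operand_eval x (mem ++ mem2) (s' l) = select x (f x) (s l).
  by rewrite /s'; case: (s l) => [i|j] //=; rewrite en operand_clipP -eP.
rewrite en -[X in foldl _ X _]cats0 (foldl_subst _ _ sP).
exact: operand_substP.
Qed.

Lemma computable_select (I J : Type) (r : J -> I + F) :
  computable (fun x j => select x id (r j)) 0.
Proof.
exists (Slp [::] (fun j => match r j with inl i => Input F i | inr c => Const I c end)) => //.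
by move=> x j; rewrite /slp_eval /=; case: (r j).
Qed.

Lemma computable_reindex (I J : Type) (r : J -> I) :
  computable (fun x j => x (r j)) 0.
Proof. exact: (computable_select (fun j => inl (r j))). Qed.

Lemma computable_comp (I J O : Type) (f : (I -> F) -> J -> F)
    (g : (J -> F) -> O -> F) c1 c2 :
  computable f c1 -> computable g c2 -> computable (fun x => g (f x)) (c1 + c2).
Proof. by move=> fc gc; apply: (computable_let (@inr I J) fc gc). Qed.

Lemma computable_pre (I J O : Type) (g : (J -> F) -> O -> F) (r : J -> I) c :
  computable g c -> computable (fun x => g (fun j => x (r j))) c.
Proof. exact: (computable_comp (computable_reindex r)). Qed.

Lemma computable_post (I J O : Type) (f : (I -> F) -> J -> F) (r : O -> J) c :
  computable f c -> computable (fun x o => f x (r o)) c.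
Proof.
move=> fc; rewrite -(addn0 c).
exact: (computable_comp fc (computable_reindex r)).
Qed.

Lemma computable_pad (I J O : Type) (f : (I -> F) -> J -> F) (r : O -> option J) c :
  computable f c ->
  computable (fun x o => if r o is Some j then f x j else 0) c.
Proof.
move=> fc; rewrite -(addn0 c).
have := computable_comp fc
  (computable_select (fun o => if r o is Some j then inl j else inr 0)).
by move/computable_ext; apply => // x o /=; case: (r o).
Qed.

Lemma computable_pair (I J1 J2 : Type) (f1 : (I -> F) -> J1 -> F)
    (f2 : (I -> F) -> J2 -> F) c1 c2 :
  computable f1 c1 -> computable f2 c2 ->
  computable (fun x => select (f1 x) (f2 x)) (c1 + c2).
Proof.
move=> fc1 fc2.
have fc2' := computable_pre (@inl I J1) fc2.
have := computable_let id fc1 (computable_let id fc2'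
  (computable_reindex (fun e : J1 + J2 =>
     match e with inl j => inl (inr j) | inr j => inr j end))).
by move/computable_ext; apply; [rewrite addn0|move=> x [j|j]].
Qed.

Lemma computable_family (I J : Type) (K : eqType) (s : seq K)
    (f : K -> (I -> F) -> J -> F) c :
    (forall k, k \in s -> computable (f k) c) ->
  computable (fun x (kj : K * J) => if kj.1 \in s then f kj.1 x kj.2 else 0)
             (size s * c).
Proof.
elim: s => [|k s IH] fc.
  exact: (computable_select (fun=> inr 0)).
have /IH sc : forall k, k \in s -> computable (f k) c.
  by move=> l ls; apply: fc; rewrite inE ls orbT.
have kc : computable (f k) c by apply: fc; rewrite mem_head.
have := computable_post (fun kj : K * J => if kj.1 == k then inl kj.2 else inr kj)
  (computable_pair kc sc).
move/computable_ext; apply => // x [l j] /=.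
by rewrite inE; case: eqVneq => [->|].
Qed.

Lemma computable_family_nat (I J : Type) (n : nat) (f : nat -> (I -> F) -> J -> F) c :
    (forall k, (k < n)%N -> computable (f k) c) ->
  computable (fun x (kj : nat * J) => if (kj.1 < n)%N then f kj.1 x kj.2 else 0)
             (n * c).
Proof.
move=> fc.
have := @computable_family I J _ (iota 0 n) f c.
rewrite size_iota => /(_ _)/computable_ext; apply=> //.
  by move=> k; rewrite mem_iota => /fc.
by move=> x [k j] /=; rewrite mem_iota.
Qed.

Lemma computable_family_fin (I J : Type) (K : finType) (f : K -> (I -> F) -> J -> F) c :
    (forall k, computable (f k) c) ->
  computable (fun x (kj : K * J) => f kj.1 x kj.2) (#|K| * c).
Proof.
move=> fc.
have := @computable_family I J _ (enum K) f c (fun k _ => fc k).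
rewrite -cardE => /computable_ext; apply=> //.
by move=> x [k j] /=; rewrite mem_enum.
Qed.

Definition computable1 (I : Type) (g : (I -> F) -> F) (c : nat) : Prop :=
  computable (fun x (_ : unit) => g x) c.

Lemma computable1_ext (I : Type) (f g : (I -> F) -> F) c c' :
  computable1 f c -> (c <= c')%N -> f =1 g -> computable1 g c'.
Proof. by move=> fc cc fg; apply: computable_ext fc cc _ => x u. Qed.

Lemma computable1_input (I : Type) (i : I) : computable1 (fun x => x i) 0.
Proof. exact: (computable_reindex (fun=> i)). Qed.

Lemma computable1_const (I : Type) (a : F) : computable1 (fun _ : I -> F => a) 0.
Proof. exact: (computable_select (fun=> inr a)). Qed.

Lemma computable1_at (I J : Type) (f : (I -> F) -> J -> F) c j :
  computable f c -> computable1 (fun x => f x j) c.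
Proof. exact: (@computable_post _ _ _ f (fun=> j)). Qed.

Lemma computable1_arith (I : Type) (op : arith) (f g : (I -> F) -> F) c1 c2 :
  computable1 f c1 -> computable1 g c2 ->
  computable1 (fun x => arith_eval op (f x) (g x)) (c1 + c2).+1.
Proof.
move=> fc gc; rewrite -addn1.
apply: (computable_comp (computable_pair fc gc)
   (g := fun y (_ : unit) => arith_eval op (y (inl tt)) (y (inr tt)))).
by exists (Slp [:: (op, Input F (inl tt), Input F (inr tt))] (fun=> Tmp F _ 0)).
Qed.

Lemma computable1_sum (I : Type) (K : finType) (g : K -> (I -> F) -> F) c :
    (forall k, computable1 (g k) c) ->
  computable1 (fun x => \sum_k g k x) (#|K| * c.+1).
Proof.
move=> gc; rewrite cardE enumT.
have: computable1 (fun x => \sum_(k <- Finite.enum K) g k x)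
                  (size (Finite.enum K) * c.+1).
  elim: (Finite.enum K) => [|k s IH].
    by apply: computable1_ext (computable1_const _ 0) _ _ => // x; rewrite big_nil.
  apply: computable1_ext (computable1_arith OpAdd (gc k) IH) _ _ => [/=|x].
    by rewrite mulSn addSn.
  by rewrite big_cons.
by move/computable1_ext; apply=> // x; rewrite [index_enum _]unlock.
Qed.

Lemma computable_nat (I : Type) (n : nat) (g : (I -> F) -> nat -> F) c :
    (forall k, (k < n)%N -> computable1 (fun x => g x k) c) ->
  computable (fun x k => if (k < n)%N then g x k else 0) (n * c).
Proof.
move=> gc.
have := computable_post (fun k => (k, tt))
   (@computable_family_nat I unit n (fun k x _ => g x k) c gc).
by move/computable_ext; apply.
Qed.

Lemma computable_grid (I : Type) (n1 n2 : nat) (g : (I -> F) -> nat * nat -> F) c :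
    (forall i j, (i < n1)%N -> (j < n2)%N -> computable1 (fun x => g x (i, j)) c) ->
  computable (fun x ij => if (ij.1 < n1)%N && (ij.2 < n2)%N then g x ij else 0)
             (n1 * n2 * c).
Proof.
move=> gc; rewrite -mulnA.
have := @computable_family_nat I nat n1
  (fun i x j => if (j < n2)%N then g x (i, j) else 0) (n2 * c).
move=> /(_ _)/computable_ext; apply=> //.
  by move=> i i1; apply: (computable_nat (g := fun x j => g x (i, j))) => j; apply: gc.
by move=> x [i j] /=; case: ifP.
Qed.

Lemma computable_fin (I : Type) (J : finType) (g : (I -> F) -> J -> F) c :
    (forall k, computable1 (fun x => g x k) c) ->
  computable g (#|J| * c).
Proof.
move=> gc.
have := computable_post (fun k => (k, tt))
   (@computable_family_fin I unit J (fun k x _ => g x k) c gc).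
by move/computable_ext; apply.
Qed.

End Calculus.

(** * Sums of powers of roots of unity *)

Section RootsOfUnity.
Variable Q : comNzRingType.

Lemma sum_expr_mul (y : Q) (u v : nat) :
  \sum_(i < u * v) y ^+ i = (\sum_(i < u) y ^+ i) * \sum_(j < v) (y ^+ u) ^+ j.
Proof.
elim: v => [|v IH]; first by rewrite muln0 !big_ord0 mulr0.
rewrite mulnS addnC big_split_ord IH big_ord_recr /= mulrDr; congr (_ + _).
by rewrite mulr_suml; apply: eq_bigr => i _; rewrite exprD -exprM mulrC.
Qed.

Lemma expr_root1 (r : nat) (x : Q) : \sum_(b < r) x ^+ b = 0 -> x ^+ r = 1.
Proof. by move=> x0; apply/eqP; rewrite -subr_eq0 subrX1 x0 mulr0. Qed.

(** As [x ^ r = 1] and [k] is a unit modulo [r], multiplication by [k] permutes the exponents. *)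
Lemma sum_root_coprime (r k : nat) (x : Q) : prime r -> ~~ (r %| k)%N ->
  \sum_(b < r) x ^+ b = 0 -> \sum_(b < r) (x ^+ k) ^+ b = 0.
Proof.
move=> pr rk x0; have x1 := expr_root1 x0; rewrite -[RHS]x0.
have r0 := prime_gt0 pr.
pose h (b : 'I_r) : 'I_r := Ordinal (ltn_pmod (k * b) r0).
have h_inj : injective h.
  move=> b c /(congr1 val) /= /eqP.
  wlog bc : b c / (b <= c)%N.
    by move=> H; case: (leqP b c) => [/H//|/ltnW/H cb bc]; apply/esym/cb; rewrite eq_sym.
  rewrite eq_sym eqn_mod_dvd ?leq_mul2l ?bc ?orbT // -mulnBr Gauss_dvdr ?prime_coprime //.
  move=> /dvdn_leq; case: (posnP (c - b)) => [/eqP cb _|cb /(_ isT) H].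
    by apply/val_inj/eqP; rewrite eqn_leq bc -subn_eq0.
  by have := leq_ltn_trans (leq_trans H (leq_subr _ _)) (ltn_ord c); rewrite ltnn.
rewrite [RHS](reindex_inj h_inj) /=; apply: eq_bigr => b _.
by rewrite -exprM {1}(divn_eq (k * b) r) exprD mulnC exprM x1 expr1n mul1r.
Qed.

(** Here [y] is the inverse of z^(r^c): the exponent r^(d + c) - 1 stands for -1 because z^(r^(d +
    c)) = 1. The ring may have zero divisors, so the geometric sum is not divided by y^e - 1 but
    factored until a vanishing sum of [r] powers appears. *)
Lemma sum_root_prime_power (r d c : nat) (z : Q) : prime r ->
    \sum_(b < r) (z ^+ (r ^ (d + c).-1)) ^+ b = 0 -> (0 < d)%N ->
  let y := z ^+ ((r ^ (d + c)).-1 * r ^ c) in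
  forall e, \sum_(i < r ^ d) y ^+ (e * i) = if (r ^ d %| e)%N then (r ^ d)%:R else 0.
Proof.
move=> pr z0 d0 y e.
have r0 := prime_gt0 pr.
have dc : (d + c = (d + c).-1.+1)%N by rewrite prednK // addn_gt0 d0.
have zM : z ^+ (r ^ (d + c)) = 1.
  by rewrite dc expnS mulnC exprM; apply: expr_root1.
have yT : y ^+ (r ^ d) = 1.
  by rewrite -exprM -mulnA -expnD addnC mulnC exprM addnC zM expr1n.
case: ifP => [/dvdnP[e' ->]|/negbT Te].
  under eq_bigr do rewrite -mulnA mulnC -mulnA exprM yT expr1n.
  by rewrite sumr_const card_ord.
under eq_bigr do rewrite exprM.
have e0 : (0 < e)%N by case: e Te => //; rewrite dvdn0.
have [e' re' ee] := pfactor_coprime pr e0.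
move: (logn r e) ee => a ee.
have ad : (a < d)%N.
  rewrite ltnNge; apply: contra Te => da; rewrite ee dvdn_mull // dvdn_exp2l //.
(* With e = r^a e', splitting the range as r^(d - a - 1) * r * r^a isolates a sum over [r] powers of
   y^(e r^(d - a - 1)), which is a power of z^(r^(d + c - 1)) with exponent prime to [r]. *)
have -> : (r ^ d = r ^ (d - a).-1 * r * r ^ a)%N.
  by rewrite -expnSr prednK ?subn_gt0 // -expnD subnK // ltnW.
rewrite sum_expr_mul sum_expr_mul.
suff -> : \sum_(j < r) (y ^+ e ^+ (r ^ (d - a).-1)) ^+ j = 0 by rewrite mulr0 mul0r.
have -> : y ^+ e ^+ (r ^ (d - a).-1)
   = (z ^+ (r ^ (d + c).-1)) ^+ ((r ^ (d + c)).-1 * e').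
  rewrite /y -!exprM; congr (_ ^+ _).
  have -> : ((d + c).-1 = c + (a + (d - a).-1))%N by lia.
  rewrite ee !expnD; move: (r ^ _)%N (r ^ _)%N (r ^ _)%N _.-1 => u v w q.
  ring.
apply: sum_root_coprime => //.
rewrite Euclid_dvdM // negb_or; apply/andP; split; last first.
  by rewrite -prime_coprime.
rewrite -(dvdn_addr _ (dvdnn r)) dc expnS.
have : (0 < r * r ^ (d + c).-1)%N by rewrite muln_gt0 r0 expn_gt0 r0.
move=> M0; apply/negP => H.
have : (r %| r + r * r ^ (d + c).-1)%N by rewrite dvdn_addr // dvdn_mulr.
have -> : (r + r * r ^ (d + c).-1 = (r + (r * r ^ (d + c).-1).-1) + 1)%N by lia.
rewrite dvdn_addr // dvdn1 => /eqP r1.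
by rewrite r1 in pr.
Qed.

(** Convolution theorem: orthogonality of the powers of [y] selects j1 + j2 = j modulo [T]. The
    inverse transform is evaluated at -j modulo [T]; the factor [T] is divided out later. *)
Lemma idft_conv (y : Q) (T : nat) (f g : nat -> Q) (j : nat) :
    (forall e, \sum_(i < T) y ^+ (e * i) = if (T %| e)%N then T%:R else 0) ->
    (j < T)%N ->
  \sum_(i < T) (\sum_(j1 < T) f j1 * y ^+ (i * j1))
    * (\sum_(j2 < T) g j2 * y ^+ (i * j2)) * y ^+ (i * ((T - j) %% T))
  = T%:R * \sum_(j1 < T) \sum_(j2 < T | ((j1 + j2) %% T == j)%N) f j1 * g j2.
Proof.
move=> orth jT.
have T0 : (0 < T)%N by case: T jT {orth}.
transitivity (\sum_(j1 < T) \sum_(j2 < T) f j1 * g j2 *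
    \sum_(i < T) y ^+ ((j1 + j2 + (T - j) %% T) * i)).
  transitivity (\sum_(i < T) \sum_(j1 < T) \sum_(j2 < T)
      f j1 * g j2 * y ^+ ((j1 + j2 + (T - j) %% T) * i)).
    apply: eq_bigr => i _; rewrite !mulr_suml; apply: eq_bigr => j1 _.
    rewrite mulr_sumr mulr_suml; apply: eq_bigr => j2 _.
    by rewrite !mulnDl !exprD ![(i * _)%N]mulnC mulrACA !mulrA.
  rewrite exchange_big; apply: eq_bigr => j1 _.
  rewrite exchange_big; apply: eq_bigr => j2 _.
  by rewrite -mulr_sumr.
rewrite mulr_sumr; apply: eq_bigr => j1 _.
rewrite mulr_sumr [RHS]big_mkcond; apply: eq_bigr => j2 _.
rewrite orth.
have -> : (T %| j1 + j2 + (T - j) %% T)%N = ((j1 + j2) %% T == j)%N.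
  rewrite /dvdn modnDmr.
  have -> : (0 = T %% T)%N by rewrite modnn.
  rewrite -(eqn_modDr j) -addnA subnK; last exact: ltnW.
  by rewrite modnDr modnDl (modn_small jT).
by case: ifP => _; rewrite ?mulr0 // mulrC.
Qed.

End RootsOfUnity.

(** * Polynomial products by a cyclic Fourier transform *)

Section PolynomialArithmetic.
Variable F : fieldType.

Definition vanishes (n : nat) (f : nat -> F) : Prop :=
  forall k, (n <= k)%N -> f k = 0.

Definition convolution (f g : nat -> F) (k : nat) : F :=
  \sum_(i < k.+1) f i * g (k - i)%N.

Lemma convolution_coef (n : nat) (f g : nat -> F) k : vanishes n f -> vanishes n g ->
  convolution f g k = ((\poly_(i < n) f i) * (\poly_(i < n) g i))`_k.
Proof.
move=> fn gn; rewrite coefM; apply: eq_bigr => i _; rewrite !coef_poly.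
by congr (_ * _); case: ltnP => //; [move/fn | move/gn].
Qed.

Lemma poly_blocks (t m : nat) (f : nat -> F) :
  \poly_(k < t * m) f k = \sum_(j < t) (\poly_(l < m) f (j * m + l)%N) * 'X^(j * m).
Proof.
elim: t => [|t IH]; first by rewrite big_ord0 poly_def big_ord0.
rewrite big_ord_recr -IH; apply/polyP => k /=.
rewrite coefD coefMXn !coef_poly mulSn; case: (ltnP k (t * m)) => kt.
  by rewrite (leq_trans kt) ?leq_addl // addr0.
by rewrite subnKC // add0r ltn_subLR // addnC.
Qed.

(* The transform of a sequence of [T] elements of F[x]/(x^M - 1), the row [j] of
   [x] being the [j]-th one, at the powers of x^(-w). *)
Definition dft (M T w : nat) (x : nat * nat -> F) (i l : nat) : F :=
  \sum_(j < T) x (j : nat, ((l + w * i * j) %% M)%N).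

(** Reduction modulo x^M - 1 of a polynomial of length at most 2 M. *)
Definition fold_cyclic (M : nat) (p : nat -> F) (l : nat) : F :=
  if (l < M)%N then p l + p (l + M)%N else 0.

Definition rows (t m : nat) (f : nat -> F) (jl : nat * nat) : F :=
  if (jl.1 < t)%N && (jl.2 < m)%N then f (jl.1 * m + jl.2)%N else 0.

Definition dft_row (M T w : nat) (x : nat * nat -> F) (i l : nat) : F :=
  if (l < M)%N then dft M T w x i l else 0.

Definition overlap_add (m : nat) (h : nat -> nat -> F) (k : nat) : F :=
  h (k %/ m)%N (k %% m)%N
  + if (0 < k %/ m)%N then h (k %/ m).-1 (k %% m + m)%N else 0.

(** Each summand has at most 2 m coefficients before its shift, so only the one numbered [k %/ m]
    and its predecessor reach coefficient [k]. *)
Lemma overlap_addE (T m : nat) (c : nat -> {poly F}) (k : nat) : (0 < m)%N ->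
    (forall j, size (c j) <= m + m)%N -> (k < T * m)%N ->
  overlap_add m (fun j l => (c j)`_l) k = (\sum_(j < T) c j * 'X^(j * m))`_k.
Proof.
move=> m0 sc; rewrite /overlap_add coef_sum.
move: (divn_eq k m) (ltn_pmod k m0).
move: (k %/ m)%N (k %% m)%N => q s -> {k} sm kT.
have qT : (q < T)%N by rewrite -(ltn_pmul2r m0); apply: leq_ltn_trans kT; apply: leq_addr.
pose G j := (c j * 'X^(j * m))`_(q * m + s).
have G0 j : (j != q)%N -> (j.+1 != q)%N -> G j = 0.
  move=> j1 j2; rewrite /G coefMXn; case: ltnP => // jk.
  rewrite nth_default //; apply: leq_trans (sc j) _.
  have jq : (j < q.+1)%N by rewrite -(ltn_pmul2r m0) mulSn; lia.
  have : (j.+2 <= q)%N by lia.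
  rewrite -(leq_pmul2r m0) !mulSn; lia.
have Gq : G q = (c q)`_s by rewrite /G coefMXn ltnNge leq_addr /= addKn.
rewrite (bigD1 (Ordinal qT)) //= -/(G _) Gq; congr (_ + _).
case: q => [|q] in kT qT G G0 Gq *.
  by rewrite big1 // => j j0; apply: G0.
have qT' : (q < T)%N by apply: ltnW.
rewrite (bigD1 (Ordinal qT')) /=; last by rewrite -val_eqE /=; lia.
have Gq' : G q = (c q)`_(s + m).
  by rewrite /G coefMXn mulSn -addnA addnC -addnA ltnNge leq_addr /= addKn addnC.
rewrite -/(G q) Gq' big1 ?addr0 // => j.
by rewrite -!val_eqE /= => /andP[j1 j2]; apply: G0.
Qed.

(** * Cyclic shifts as multiplication by roots of unity *)

Section CyclicShift.
Variables (Q : comNzRingType) (phi : {rmorphism {poly F} -> Q}) (M : nat).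
Hypothesis M0 : (0 < M)%N.
Hypothesis zM : phi 'X ^+ M = 1.

Lemma phi_poly n (u : nat -> F) :
  phi (\poly_(l < n) u l) = \sum_(l < n) phi (u l)%:P * phi 'X ^+ l.
Proof.
rewrite poly_def rmorph_sum; apply: eq_bigr => l _.
by rewrite -mul_polyC rmorphM rmorphXn.
Qed.

(** Multiplication by a root of unity is a mere renaming of coefficients, so the transform needs
    additions only. The factor [M.-1] in the exponent stands for -1. *)
Lemma phi_shift (u : nat -> F) k :
  phi (\poly_(l < M) u ((l + k) %% M)%N)
  = phi (\poly_(l < M) u l) * phi 'X ^+ (M.-1 * k).
Proof.
rewrite !phi_poly mulr_suml.
pose h (l : 'I_M) : 'I_M := Ordinal (ltn_pmod (l + k) M0).
have h_inj : injective h.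
  move=> l l' /(congr1 val) /= /eqP; rewrite eqn_modDr !modn_small // => /eqP.
  exact: val_inj.
rewrite [RHS](reindex_inj h_inj) /=; apply: eq_bigr => l _.
rewrite -mulrA; congr (_ * _).
have zmod n : phi 'X ^+ (n %% M) = phi 'X ^+ n.
  by rewrite {2}(divn_eq n M) exprD mulnC exprM zM expr1n mul1r.
rewrite zmod -exprD -addnA -mulSn prednK // exprD exprM zM expr1n mulr1.
by [].
Qed.

Lemma phi_dft T w (x : nat * nat -> F) i :
  phi (\poly_(l < M) dft M T w x i l)
  = \sum_(j < T) phi (\poly_(l < M) x (j : nat, l)) * (phi 'X ^+ (M.-1 * w)) ^+ (i * j).
Proof.
transitivity (\sum_(j < T) phi (\poly_(l < M) x (j : nat, ((l + w * i * j) %% M)%N))).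
  rewrite -rmorph_sum; congr (phi _); apply/polyP => l.
  rewrite coef_sum coef_poly; under [RHS]eq_bigr do rewrite coef_poly.
  by case: ifP => // _; rewrite big1.
apply: eq_bigr => j _.
by rewrite (phi_shift (fun l => x (j : nat, l))) -exprM; congr (_ * _ ^+ _); rewrite !mulnA.
Qed.

Lemma phi_fold (p : nat -> F) :
  phi (\poly_(l < M) fold_cyclic M p l) = phi (\poly_(l < M + M) p l).
Proof.
rewrite !phi_poly big_split_ord /= -big_split /=; apply: eq_bigr => l _.
rewrite /fold_cyclic ltn_ord polyCD rmorphD mulrDl addnC exprD zM mul1r.
by rewrite [(M + l)%N]addnC.
Qed.

End CyclicShift.

(** Repeating a block of length [L] gives a multiple of 1 + x^L + ... + x^((r - 1) L), hence a way
    to change the representative of a class modulo it. *)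
Lemma poly_periodic (r L : nat) (u : nat -> F) : (0 < L)%N ->
  \poly_(k < r * L) u (k %% L)%N
  = (\poly_(l < L) u l) * \sum_(b < r) ('X^L) ^+ b.
Proof.
move=> L0; rewrite poly_blocks mulr_sumr; apply: eq_bigr => j _.
rewrite -exprM mulnC; congr (_ * _); apply/polyP => l; rewrite !coef_poly.
by case: ltnP => // lL; rewrite mulnC modnMDl modn_small.
Qed.

(** * One step of the Schoenhage-Strassen recursion *)

Section SchoenhageStep.
Variables (r a b : nat).
Hypothesis pr : prime r.
Hypothesis rF : r%:R != 0 :> F.
Hypothesis ba : (b <= a.+1)%N.

(** The [t] blocks of length [m] are transformed at T = r t points, at least 2 t, so that their
    product does not wrap around. Modulo [Phi] one has x^M = 1, and w T = M, so the powers of x^w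
    serve as the [T] evaluation points. *)
Let m := (r ^ a)%N.
Let t := (r ^ b)%N.
Let T := (r ^ b.+1)%N.
Let L := (r ^ a.+1)%N.
Let M := (r ^ a.+2)%N.
Let w := (r ^ (a.+1 - b))%N.

Let Phi : {poly F} := \sum_(c < r) ('X^L) ^+ c.

Let r1 : (1 < r)%N := prime_gt1 pr.
Let L0 : (0 < L)%N. Proof. by rewrite expn_gt0 prime_gt0. Qed.
Let M0 : (0 < M)%N. Proof. by rewrite expn_gt0 prime_gt0. Qed.
Let m0 : (0 < m)%N. Proof. by rewrite expn_gt0 prime_gt0. Qed.
Let ML : M = (r * L)%N. Proof. by rewrite -expnS. Qed.
Let mL : (m + m <= L)%N.
Proof. by rewrite addnn -mul2n /L expnS leq_mul2r r1 orbT. Qed.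

Lemma size_monic_Phi : size Phi = (r.-1 * L).+1 /\ Phi \is monic.
Proof.
have e : ('X^L - 1) * Phi = 'X^M - 1 :> {poly F}.
  by rewrite -subrX1 -exprM mulnC -ML.
have XL := monic_Xn_sub_1 F L0; have XM := monic_Xn_sub_1 F M0.
have mPhi : Phi \is monic by rewrite -(monicMl _ XL) e.
split=> //.
move/(congr1 (fun p : {poly F} => size p)): e.
rewrite size_monicM ?monic_neq0 // -!polyC1 !size_XnsubC //= => e.
have -> : size Phi = (M.+1 - L)%N by rewrite -e addKn.
by rewrite ML -{1}(prednK (prime_gt0 pr)) mulSn -addnS addKn.
Qed.

(* The inverse transform is the same transform read at [-j].  The rows it returns
   are correct only modulo Phi; as x^(M - L) = - (1 + ... + x^(M - 2 L)) modulo Phi,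
   subtracting the top block of length L from the others gives the representative
   of degree less than M - L. *)
Lemma schoenhage_step (f g : nat -> F) (p : nat -> nat -> F) :
  let D := dft_row M T w (fun il => fold_cyclic M (p il.1) il.2) in
  vanishes (t * m) f -> vanishes (t * m) g ->
  (forall i k, (i < T)%N ->
     p i k = convolution (dft_row M T w (rows t m f) i) (dft_row M T w (rows t m g) i) k) ->
  forall k, convolution f g k = if (k < T * m)%N then overlap_add m (fun j l =>
      T%:R^-1 * (D ((T - j) %% T)%N l - D ((T - j) %% T)%N (l + r.-1 * L)%N)) k else 0.
Proof.
move=> D f0 g0 pE k.
have [sPhi mPhi] := size_monic_Phi.
have T0 : (0 < T)%N by rewrite expn_gt0 prime_gt0.
have tT : (t + t <= T)%N by rewrite addnn -mul2n /T expnS leq_mul2r r1 orbT.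
have r10 : (0 < r.-1)%N by rewrite -ltnS prednK // prime_gt0.
pose blk (h : nat -> F) j : {poly F} := \poly_(l < m) rows t m h (j, l).
pose c (j : nat) : {poly F} :=
  \sum_(j1 < T) \sum_(j2 < T | ((j1 + j2) %% T == j)%N) blk f j1 * blk g j2.
have blk0 h j : (t <= j)%N -> blk h j = 0.
  by move=> tj; apply/polyP => l; rewrite coef_poly coef0 /rows /= [(j < t)%N]ltnNge tj; case: ifP.
have sc j : (size (c j) <= m + m)%N.
  apply: (big_ind (fun q : {poly F} => (size q <= m + m)%N)).
  - by rewrite size_poly0.
  - by move=> u v su sv; rewrite (leq_trans (size_polyD _ _)) // geq_max su.
  move=> j1 _; apply: (big_ind (fun q : {poly F} => (size q <= m + m)%N)).
  - by rewrite size_poly0.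
  - by move=> u v su sv; rewrite (leq_trans (size_polyD _ _)) // geq_max su.
  move=> j2 _; apply: leq_trans (size_polyMleq _ _) _.
  by apply: leq_trans (leq_pred _) _; rewrite leq_add ?size_poly.
have polyE h : \poly_(k < t * m) h k = \sum_(j < T) blk h j * 'X^(j * m).
  rewrite poly_blocks.
  rewrite [RHS](bigID (fun j : 'I_T => (j < t)%N)) /= [X in _ + X]big1 ?addr0; last first.
    by move=> j; rewrite -leqNgt => /blk0 ->; rewrite mul0r.
  rewrite (big_ord_widen _ (fun j => (\poly_(l < m) h (j * m + l)%N) * 'X^(j * m))
     (leq_trans (leq_addr _ _) tT)).
  apply: eq_bigr => j jt; congr (_ * _); apply/polyP => l; rewrite !coef_poly.
  by case: ifP => // lm; rewrite /rows /= jt lm.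
(* Blocks from [t] on vanish and t + t <= T, so the reduction of j1 + j2 modulo [T] has no
   effect. *)
have convE : convolution f g k = (\sum_(j < T) c j * 'X^(j * m))`_k.
  rewrite (convolution_coef _ f0 g0) !polyE; congr (nth 0 (polyseq _) k).
  under [RHS]eq_bigr do rewrite mulr_suml.
  rewrite exchange_big mulr_suml; apply: eq_bigr => j1 _.
  under [RHS]eq_bigr do rewrite mulr_suml big_mkcond.
  rewrite exchange_big mulr_sumr; apply: eq_bigr => j2 _ /=.
  rewrite -big_mkcond /=.
  have [j1t|/blk0 ->] := ltnP j1 t; last by rewrite !mul0r big1 // => i; rewrite !mul0r.
  have [j2t|/blk0 ->] := ltnP j2 t; last first.
    by rewrite mul0r mulr0 big1 // => i; rewrite mulr0 mul0r.
  have jT : (j1 + j2 < T)%N by lia.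
  rewrite (big_pred1 (Ordinal jT)).
    by rewrite mulrACA -exprD -mulnDl.
  by move=> i /=; rewrite modn_small // eq_sym -val_eqE.
case: ltnP => kT; last first.
  rewrite (convolution_coef _ f0 g0) nth_default //.
  apply: leq_trans (size_polyMleq _ _) _; apply: leq_trans (leq_pred _) _.
  apply: leq_trans kT; apply: leq_trans (leq_mul tT (leqnn m)).
  by rewrite mulnDl leq_add ?size_poly.
rewrite convE -overlap_addE //.
pose phi : {rmorphism {poly F} -> {poly %/ Phi}} := in_qpoly Phi.
have L0' : (0 < r.-1 * L)%N by rewrite muln_gt0 r10.
have mkPhi : mk_monic Phi = Phi by rewrite /mk_monic sPhi mPhi ltnS L0'.
(* Products of blocks have degree below that of [Phi], so they can be recovered from their
   classes. *)
have phi_inj (p1 p2 : {poly F}) : (size p1 <= r.-1 * L)%N -> (size p2 <= r.-1 * L)%N ->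
    phi p1 = phi p2 -> p1 = p2.
  move=> s1 s2 e.
  have : polyn (in_qpoly Phi p1) = polyn (in_qpoly Phi p2) := congr1 (@polyn _ _) e.
  by rewrite !in_qpoly_small // mkPhi sPhi ltnS.
have phi0 : phi Phi = 0.
  by apply: val_inj; rewrite /= mkPhi Pdiv.RingMonic.rmodpp.
have z0 : \sum_(i < r) (phi 'X ^+ L) ^+ i = 0.
  by rewrite -[RHS]phi0 /Phi rmorph_sum; apply: eq_bigr => i _; rewrite !rmorphXn.
have zM : phi 'X ^+ M = 1 by rewrite ML mulnC exprM (expr_root1 z0).
have mL' : (m + m <= M)%N by apply: leq_trans mL _; rewrite ML leq_pmull // prime_gt0.
have dw : (b.+1 + (a.+1 - b) = a.+2)%N by rewrite addSn subnKC.
have orth := @sum_root_prime_power _ r b.+1 (a.+1 - b) (phi 'X) pr.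
rewrite dw in orth; move: (orth z0 isT) => /= {}orth.
pose y := phi 'X ^+ (M.-1 * w).
have poly_row h i : phi (\poly_(l < M) dft_row M T w h i l)
    = \sum_(j < T) phi (\poly_(l < M) h (j : nat, l)) * y ^+ (i * j).
  rewrite -phi_dft //.
  suff -> : \poly_(l < M) dft_row M T w h i l = \poly_(l < M) dft M T w h i l by [].
  by apply/polyP => l; rewrite !coef_poly /dft_row; case: ifP => // ->.
have poly_rows h j : \poly_(l < M) rows t m h (j, l) = blk h j.
  apply/polyP => l; rewrite /blk !coef_poly /rows /=.
  case: (ltnP l m) => lm; last by rewrite andbF; case: ifP.
  by rewrite (leq_trans lm (leq_trans (leq_addr _ _) mL')).
have phi_p i : (i < T)%N -> phi (\poly_(l < M) fold_cyclic M (p i) l)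
    = (\sum_(j1 < T) phi (blk f j1) * y ^+ (i * j1))
      * (\sum_(j2 < T) phi (blk g j2) * y ^+ (i * j2)).
  move=> iT; rewrite phi_fold //.
  have van h : vanishes M (dft_row M T w (rows t m h) i).
    by move=> l Ml; rewrite /dft_row ltnNge Ml.
  have -> : \poly_(l < M + M) p i l =
     \poly_(l < M) dft_row M T w (rows t m f) i l
     * \poly_(l < M) dft_row M T w (rows t m g) i l.
    apply/polyP => l; rewrite coef_poly pE // (convolution_coef _ (van f) (van g)).
    case: ltnP => // Ml; rewrite nth_default //.
    apply: leq_trans (size_polyMleq _ _) _; apply: leq_trans (leq_pred _) _.
    by apply: leq_trans Ml; rewrite leq_add ?size_poly.
  rewrite rmorphM !poly_row; congr (_ * _); apply: eq_bigr => j1 _;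
    by rewrite poly_rows.
have hE j l : (j < T)%N -> (l < m + m)%N ->
    (c j)`_l = T%:R^-1 * (D ((T - j) %% T)%N l - D ((T - j) %% T)%N (l + r.-1 * L)%N).
  move=> jT lm.
  pose H l := T%:R^-1 * D ((T - j) %% T)%N l.
  pose u l := H (l + r.-1 * L)%N.
  (* [u] is the top block of length [L] of [H]; subtracting the corresponding multiple of [Phi]
     clears this block and keeps the class. *)
  pose Red := \poly_(l < M) H l - (\poly_(l < L) u l) * Phi.
  have RedE l' : Red`_l' = if (l' < M)%N then H l' - u (l' %% L)%N else 0.
    rewrite /Red -poly_periodic // -ML coefB !coef_poly.
    by case: ifP; rewrite ?subr0.
  have sRed : (size Red <= r.-1 * L)%N.
    apply/leq_sizeP => l' Ll'; rewrite RedE; case: ltnP => // l'M.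
    rewrite /u; suff -> : (l' %% L + r.-1 * L = l')%N by rewrite subrr.
    have -> : (l' = r.-1 * L + (l' - r.-1 * L))%N by rewrite subnKC.
    rewrite modnMDl modn_small; first by rewrite addnC.
    by rewrite ltn_subLR // -mulSnr prednK -?ML // prime_gt0.
  have phiRed : phi Red = phi (c j).
    rewrite /Red rmorphB rmorphM phi0 mulr0 subr0.
    have -> : \poly_(l < M) H l = (T%:R^-1)%:P * \poly_(l < M) D ((T - j) %% T)%N l.
      by apply/polyP => l'; rewrite coefCM !coef_poly; case: ifP; rewrite ?mulr0.
    rewrite rmorphM poly_row.
    under eq_bigr => i _ do rewrite phi_p // [(_ * i)%N]mulnC.
    rewrite (@idft_conv _ y T (fun j => phi (blk f j)) (fun j => phi (blk g j)) j) //.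
    have -> : T%:R = phi (T%:R)%:P by rewrite polyC_natr rmorph_nat.
    (* [T] is a power of [r], hence invertible in [F]. *)
    rewrite mulrA -rmorphM -polyCM mulVf; last by rewrite natrX expf_neq0.
    rewrite polyC1 rmorph1 mul1r rmorph_sum; apply: eq_bigr => j1 _.
    by rewrite rmorph_sum; apply: eq_bigr => j2 _; rewrite rmorphM.
  rewrite -(phi_inj _ _ sRed _ phiRed); last first.
    apply: leq_trans (sc j) _; apply: leq_trans mL _.
    by rewrite -{1}[L]mul1n leq_mul2r r10 orbT.
  have lL : (l < L)%N by apply: leq_trans mL.
  rewrite RedE modn_small // ML (leq_trans lL); last by rewrite -{1}[L]mul1n leq_mul2r ltnW ?orbT.
  by rewrite /u /H mulrBr.
rewrite /overlap_add.
have km := ltn_pmod k m0.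
have kT' : (k %/ m < T)%N by rewrite ltn_divLR.
rewrite hE ?(leq_trans km) ?leq_addr //; congr (_ + _).
by case: posnP => // k0; rewrite hE ?ltn_add2r // (leq_ltn_trans (leq_pred _)).
Qed.
End SchoenhageStep.
End PolynomialArithmetic.

(** * Quasi-linear bilinear multiplication *)

Section FastMultiplication.
Variable F : fieldType.

Lemma sum_mul_ord (r u : nat) (G : nat -> F) :
  \sum_(j < r * u) G j = \sum_(a < r) \sum_(j < u) G (r * j + a)%N.
Proof.
elim: u => [|u IH].
  by rewrite muln0 big_ord0 big1 // => a _; rewrite big_ord0.
rewrite mulnS addnC big_split_ord /= IH -big_split /=; apply: eq_bigr => a _.
by rewrite big_ord_recr.
Qed.

(** Radix-[r] splitting by the residue of [j] modulo [r]. The twiddle factors are shifts, and [i]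
    may be reduced modulo [u] because w r u is a multiple of [M]. *)
Lemma dft_split (M r u w : nat) (x : nat * nat -> F) (i l : nat) :
    (M %| w * (r * u))%N ->
  dft M (r * u) w x i l
  = \sum_(a < r) dft M u (w * r) (fun jl => x (r * jl.1 + a, jl.2)%N)
                     (i %% u) ((l + w * i * a) %% M).
Proof.
move=> Mw; rewrite /dft (sum_mul_ord _ _ (fun j => x (j, ((l + w * i * j) %% M)%N))).
apply: eq_bigr => a _; apply: eq_bigr => j _ /=; congr (x (_, _)).
rewrite modnDml -addnA; apply/eqP; rewrite eqn_modDl {1}(divn_eq i u).
have /dvdnP[q Mq] := Mw.
have -> : (w * (i %/ u * u + i %% u) * (r * j + a)
  = (i %/ u * j * q) * M + (w * (i %/ u * u + i %% u) * a + w * r * (i %% u) * j))%N.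
  by rewrite -[(_ * q * M)%N]mulnA -Mq; ring.
by rewrite modnMDl -divn_eq.
Qed.

(** Each of the [d] levels produces r^d M entries, each of them a sum of [r] terms; [w] is
    multiplied by [r] from one level to the next. *)
Lemma computable_dft (r M d w : nat) : (0 < r)%N -> (0 < M)%N ->
    (M %| w * r ^ d)%N ->
  computable (fun (x : nat * nat -> F) il =>
      if (il.1 < r ^ d)%N && (il.2 < M)%N then dft M (r ^ d) w x il.1 il.2 else 0)
    (d * r ^ d.+1 * M).
Proof.
move=> r0 M0; elim: d w => [|d IH] w Mw.
  apply: computable_ext (computable_pad (fun il =>
    if (il.1 < 1)%N && (il.2 < M)%N then Some il else None)
      (computable_reindex F (@id (nat * nat)))) _ _ => // x [i l] /=.
  rewrite expn0; case: ifP => //= /andP[]; rewrite ltnS leqn0 => /eqP -> lM.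
  by rewrite /dft big_ord_recl big_ord0 muln0 mul0n addn0 modn_small // addr0.
have Mw' : (M %| w * r * r ^ d)%N by rewrite -mulnA -expnS.
have c1 := @computable_family_nat F _ _ r (fun a (x : nat * nat -> F) =>
  _ (fun jl => x (r * jl.1 + a, jl.2)%N)) _ (fun a _ => computable_pre _ (IH _ Mw')).
have c2 := @computable_grid F (nat * (nat * nat)) (r ^ d.+1) M (fun y il =>
  \sum_(a < r) y (a : nat, (il.1 %% r ^ d, (il.2 + w * il.1 * a) %% M)%N)) r.
have := computable_comp c1 (c2 _).
move=> /(_ _)/computable_ext; apply.
- move=> i j _ _; apply: computable1_ext (computable1_sum (fun a => computable1_input F
   ((a : 'I_r) : nat, (i %% r ^ d, (j + w * i * a) %% M)%N))) _ _ => //.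
  by rewrite card_ord muln1.
- by rewrite !expnS mulSn; move: (r ^ d)%N => e; nia.
- move=> x [i l] /=; case: ifP => // /andP[id lM].
  rewrite [in RHS]expnS dft_split -?expnS //; apply: eq_bigr => a _.
  by rewrite ltn_ord !ltn_mod expn_gt0 r0 M0.
Qed.

(* A bilinear algorithm for the product of two polynomials with [n] coefficients:
   two linear maps, [#|Rt|] products, and one linear map; only the additivity of
   the last map is recorded. *)
Definition fastmul (n c : nat) : Prop :=
  exists (Rt : finType) (al be : (nat -> F) -> Rt -> F) (ga : (Rt -> F) -> nat -> F),
  [/\ (#|Rt| <= c)%N,
      [/\ computable al c, computable be c & computable ga c],
      forall u v k, ga (fun i => u i + v i) k = ga u k + ga v k
    & forall f g, vanishes n f -> vanishes n g ->
        forall k, convolution f g k = ga (fun i => al f i * be g i) k].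

Lemma fastmul_naive (n : nat) : fastmul n ((n + n) * (n * n) + n * n).
Proof.
pose ga (v : 'I_n * 'I_n -> F) k : F :=
  if (k < n + n)%N then \sum_(ij : 'I_n * 'I_n) if (ij.1 + ij.2 == k)%N then v ij else 0
  else 0.
exists ('I_n * 'I_n)%type, (fun f ij => f (nat_of_ord ij.1)), (fun f ij => f (nat_of_ord ij.2)), ga.
split.
- by rewrite card_prod card_ord leq_addl.
- split.
  + exact: computable_leq (computable_reindex F _) _.
  + exact: computable_leq (computable_reindex F _) _.
  + apply: computable_leq (leq_addr _ _); apply: (computable_nat (g := fun v k =>
      \sum_(ij : 'I_n * 'I_n) if (ij.1 + ij.2 == k)%N then v ij else 0)) => k _.
    apply: computable1_ext (computable1_sum (c := 0)
      (g := fun (ij : 'I_n * 'I_n) v => if (ij.1 + ij.2 == k)%N then v ij else 0) _) _ _ => //.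
    * by move=> ij; case: eqP => _; [exact: computable1_input|exact: computable1_const].
    * by rewrite card_prod card_ord muln1.
- move=> u v k; rewrite /ga; case: ifP => _; rewrite ?addr0 // -big_split /=.
  by apply: eq_bigr => ij _; case: ifP; rewrite ?addr0.
- move=> f g fn gn k; rewrite /ga.
  rewrite (convolution_coef _ fn gn); case: ltnP => [_|nk]; last first.
    rewrite nth_default //; apply: leq_trans (size_polyMleq _ _) _.
    by apply: leq_trans (leq_pred _) (leq_trans _ nk); rewrite leq_add ?size_poly.
  rewrite -(pair_bigA _ (fun i j : 'I_n => if (i + j == k)%N then f i * g j else 0)) /=.
  rewrite !poly_def mulr_suml coef_sum; apply: eq_bigr => i _.
  rewrite mulr_sumr coef_sum; apply: eq_bigr => j _.
  rewrite -scalerAl -scalerAr -exprD !coefZ coefXn eq_sym.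
  by case: eqP; rewrite ?mulr1 ?mulr0.
Qed.

(** The transforms are linear, so r^(b + 1) recursive products of length r^(a + 2) again give a
    bilinear algorithm. The summands pay for these products, the Fourier transform, the folding
    modulo x^M - 1, and five operations for each coefficient of the result. *)
Lemma fastmul_step (r a b c : nat) :
    prime r -> r%:R != 0 :> F -> (b <= a.+1)%N -> fastmul (r ^ a.+2) c ->
  fastmul (r ^ b * r ^ a)
    (r ^ b.+1 * c + b.+1 * r ^ b.+2 * r ^ a.+2 + r ^ b.+1 * r ^ a.+2
     + r ^ b.+1 * r ^ a * 5).
Proof.
move=> pr rF ba [Rt [al [be [ga [cR [cal cbe cga] gaD gaE]]]]].
have r0 := prime_gt0 pr.
pose m := (r ^ a)%N; pose t := (r ^ b)%N; pose T := (r ^ b.+1)%N.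
pose L := (r ^ a.+1)%N; pose M := (r ^ a.+2)%N; pose w := (r ^ (a.+1 - b))%N.
have M0 : (0 < M)%N by rewrite expn_gt0 r0.
have T0 : (0 < T)%N by rewrite expn_gt0 r0.
have Mw : (M %| w * r ^ b.+1)%N by rewrite /M /w -expnD addnS subnK.
have cdft := computable_dft r0 M0 Mw; rewrite -/T in cdft.
have clin A : computable A c -> computable
    (fun f (it : 'I_T * Rt) => A (dft_row M T w (rows t m f) it.1) it.2 : F)
    (T * c + b.+1 * r ^ b.+2 * M).
  move=> cA.
  have crows : computable (rows t m : (nat -> F) -> _) 0.
    have := computable_pad (fun jl : nat * nat => if (jl.1 < t)%N && (jl.2 < m)%N
      then Some (jl.1 * m + jl.2)%N else None) (computable_reindex F id).
    by move/computable_ext; apply => // x jl; rewrite /rows; case: ifP.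
  have := computable_comp (computable_comp crows cdft)
    (computable_family_fin (fun i : 'I_T => computable_pre (fun l => (i : nat, l)) cA)).
  move/computable_ext; apply; first by rewrite card_ord addnC.
  move=> x [i s] /=; congr (A _ s); apply: funext => l.
  by rewrite ltn_ord.
pose p (v : 'I_T * Rt -> F) i k : F :=
  if insub i is Some i' then ga (fun s => v (i', s)) k else 0.
pose D v := dft_row M T w (fun il => fold_cyclic M (p v il.1) il.2).
pose h v j l : F :=
  T%:R^-1 * (D v ((T - j) %% T)%N l - D v ((T - j) %% T)%N (l + r.-1 * L)%N).
pose ga' v k := if (k < T * m)%N then overlap_add m (h v) k else 0.
exists ('I_T * Rt)%type,
  (fun f it => al (dft_row M T w (rows t m f) (nat_of_ord it.1)) it.2),
  (fun f it => be (dft_row M T w (rows t m f) (nat_of_ord it.1)) it.2), ga'.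
split.
- rewrite card_prod card_ord -!addnA; apply: leq_trans (leq_addr _ _).
  by rewrite leq_mul.
- split.
  + by apply: computable_leq (clin _ cal) _; rewrite -!addnA !leq_add2l leq_addr.
  + by apply: computable_leq (clin _ cbe) _; rewrite -!addnA !leq_add2l leq_addr.
  have cp : computable (fun v (ik : nat * nat) => p v ik.1 ik.2) (T * c).
    have := computable_pad (fun ik : nat * nat =>
        if insub ik.1 is Some i' then Some (i' : 'I_T, ik.2) else None)
      (computable_family_fin (fun i : 'I_T => computable_pre (fun s => (i, s)) cga)).
    move/computable_ext; apply; first by rewrite card_ord.
    by move=> v [i k] /=; rewrite /p; case: insub.
  have cfold : computable (fun v (il : nat * nat) => fold_cyclic M (p v il.1) il.2)
      (T * c + T * M).
    have := computable_comp cp (computable_grid (n1 := T) (n2 := M) (c := 1)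
      (g := fun y il => y (il.1, il.2) + y (il.1, il.2 + M)%N) _).
    move=> /(_ _)/computable_ext; apply; last 2 first.
    * by rewrite muln1.
    * move=> v [i l] /=; rewrite /fold_cyclic /p.
      case: insubP => /= [i' iT _|/negbTE ->]; first by rewrite iT.
      by rewrite addr0; case: ifP.
    * move=> i j _ _.
      exact: (computable1_arith OpAdd (computable1_input _ _) (computable1_input _ _)).
  have := computable_comp (computable_comp cfold cdft)
    (computable_nat (n := T * m) (c := 5)
      (g := fun y => overlap_add m (fun j l => T%:R^-1 * (y (((T - j) %% T)%N, l)
                       - y (((T - j) %% T)%N, (l + r.-1 * L)%N)))) _).
  move=> /(_ _)/computable_ext; apply.
  * move=> k _; rewrite /overlap_add.
    have ch j l : computable1 (fun y : nat * nat -> F => T%:R^-1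
       * (y (((T - j) %% T)%N, l) - y (((T - j) %% T)%N, (l + r.-1 * L)%N))) 2.
      apply: (computable1_arith OpMul (computable1_const _ _)).
      exact: (computable1_arith OpSub (computable1_input _ _) (computable1_input _ _)).
    case: (0 < k %/ m)%N; first exact: (computable1_arith OpAdd (ch _ _) (ch _ _)).
    by apply: computable1_ext (computable1_arith OpAdd (ch _ _) (computable1_const _ 0)) _ _.
  * by rewrite /T /M /m; lia.
  * move=> v k; rewrite /ga'; case: ifP => // _; rewrite /overlap_add /h /D /dft_row /=.
    by rewrite !ltn_pmod.
- have pD u v i k : p (fun s => u s + v s) i k = p u i k + p v i k.
    by rewrite /p; case: insub => [i'|]; rewrite ?gaD ?addr0.
  have DD u v i l : D (fun s => u s + v s) i l = D u i l + D v i l.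
    rewrite /D /dft_row; case: ifP => _; rewrite ?addr0 // /dft -big_split /=.
    apply: eq_bigr => j _; rewrite /fold_cyclic; case: ifP => _; rewrite ?addr0 // !pD.
    by rewrite addrACA.
  have hD u v j l : h (fun s => u s + v s) j l = h u j l + h v j l.
    by rewrite /h !DD -mulrDr; congr (_ * _); rewrite opprD addrACA.
  move=> u v k; rewrite /ga'; case: ifP => _; rewrite ?addr0 // /overlap_add !hD.
  by case: ifP => _; rewrite ?addr0 // addrACA.
- move=> f g fn gn k; rewrite /ga'.
  apply: (@schoenhage_step F r a b pr rF ba f g) => // i l iT.
  have van (h' : nat -> F) : vanishes M (dft_row M T w (rows t m h') i).
    by move=> l'; rewrite /dft_row ltnNge => ->.
  by rewrite (gaE _ _ (van f) (van g)) /p (insubT (fun i => (i < T)%N) iT).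
Qed.

Lemma fastmul_leq (n n' c c' : nat) :
  (n' <= n)%N -> (c <= c')%N -> fastmul n c -> fastmul n' c'.
Proof.
move=> nn cc [Rt [al [be [ga [cR [cal cbe cga] gaD gaE]]]]].
exists Rt, al, be, ga; split=> //; first exact: leq_trans cR cc.
  by split; apply: computable_leq cc.
move=> f g fn gn; apply: gaE => k nk; [apply: fn|apply: gn]; exact: leq_trans nk.
Qed.

(* With n / 2 + 2 < n in place of n the excess rank grows by r ^ 3 <= 27, while
   mu = n - 3 shrinks to at most 2 mu / 3; the exponent 10 makes 54 (2/3)^10 < 1. *)
Lemma fastmul_exp (r : nat) : prime r -> (r <= 3)%N -> r%:R != 0 :> F ->
  exists C, forall n, fastmul (r ^ n) (C * r ^ n * (n - 4).+1 ^ 10).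
Proof.
move=> pr r3 rF; have r0 := prime_gt0 pr.
have [N4 N4E] : exists N4, (N4 = r ^ 4)%N by exists (r ^ 4)%N.
have N40 : (0 < N4)%N by rewrite N4E expn_gt0 r0.
(* The first two summands cover naive multiplication for n <= 4; the last one leaves room for the
   linear maps in [h3]. *)
exists ((N4 + N4) * (N4 * N4) + N4 * N4 + 8 * N4 * 6)%N.
elim/ltn_ind => n IH; have [n4|n5] := leqP n 4.
  apply: fastmul_leq (fastmul_naive N4); first by rewrite N4E leq_exp2l // prime_gt1.
  rewrite (eqP n4) muln1 -[X in (X <= _)%N]muln1 leq_mul ?expn_gt0 ?r0 //.
  exact: leq_addr.
have : (8 * N4 * 6 <= (N4 + N4) * (N4 * N4) + N4 * N4 + 8 * N4 * 6)%N by apply: leq_addl.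
move: (_ + 8 * N4 * 6)%N IH => C IH CN.
(* The exponent is split evenly; from n = 5 on, the recursive length r^(a + 2) is smaller than
   r^n. *)
pose a := n./2; pose b := (n - a)%N.
have nE : (n = b + a)%N by rewrite /b /a; lia.
have ba : (b <= a.+1)%N by rewrite /b /a; lia.
have an : (a.+2 < n)%N by rewrite /a; lia.
have := fastmul_step pr rF ba (IH _ an).
rewrite -expnD -nE; apply: fastmul_leq => //.
have e1 : (r ^ b.+1 * r ^ a.+2 = r ^ 3 * r ^ n)%N by rewrite nE -!expnD; congr (_ ^ _)%N; lia.
have e2 : (r ^ b.+2 * r ^ a.+2 = N4 * r ^ n)%N by rewrite nE N4E -!expnD; congr (_ ^ _)%N; lia.
have e3 : (r ^ b.+1 * r ^ a = r * r ^ n)%N by rewrite nE -expnD -expnS.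
rewrite -[(b.+1 * _ * _)%N]mulnA e2 e1 e3.
have -> : (r ^ b.+1 * (C * r ^ a.+2 * (a.+2 - 4).+1 ^ 10)
   = C * (a.+2 - 4).+1 ^ 10 * (r ^ b.+1 * r ^ a.+2))%N by ring.
rewrite e1.
pose mu := (n - 4).+1; pose mu' := (a.+2 - 4).+1.
rewrite -/mu -/mu'.
have mm : (3 * mu' <= 2 * mu)%N by rewrite /mu /mu' /a; lia.
have mm10 : (54 * mu' ^ 10 <= mu ^ 10)%N.
  have : ((3 * mu') ^ 10 <= (2 * mu) ^ 10)%N by rewrite leq_exp2r.
  rewrite !expnMn; have -> : (3 ^ 10 = 243 * 243)%N by [].
  have -> : (2 ^ 10 = 32 * 32)%N by [].
  move: (mu' ^ 10)%N (mu ^ 10)%N => u v; lia.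
have bmu : (b.+1 <= 3 * mu)%N by rewrite /mu /b /a; lia.
have mu1 : (mu <= mu ^ 10)%N by rewrite -{1}[mu]expn1 leq_pexp2l.
have r27 : (r ^ 3 <= 27)%N by rewrite -[27%N]/(3 ^ 3)%N leq_exp2r.
have rN4 : (r ^ 3 <= N4)%N by rewrite N4E leq_pexp2l.
have r1N4 : (r <= N4)%N by rewrite N4E -{1}[r]expn1 leq_pexp2l.
(* Half of the target [C * mu ^ 10] goes to the recursive products, the other half to the linear
   maps. *)
have h1 : (C * mu' ^ 10 * r ^ 3 * 2 <= C * mu ^ 10)%N.
  rewrite -mulnA -mulnA leq_mul2l; apply/orP; right.
  apply: leq_trans mm10; rewrite mulnC leq_mul2r; apply/orP; right; lia.
have h2 : (b.+1 * N4 + r ^ 3 + r * 5 <= 8 * N4 * (3 * mu ^ 10))%N.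
  apply: (@leq_trans (8 * N4 * (3 * mu))%N); last by rewrite !leq_mul2l mu1 !orbT.
  have : (b.+1 * N4 <= 3 * (mu * N4))%N by rewrite mulnA leq_mul2r bmu orbT.
  have : (1 * N4 <= mu * N4)%N by rewrite leq_mul2r orbT.
  have -> : (8 * N4 * (3 * mu) = 24 * (mu * N4))%N by ring.
  move: rN4 r1N4; rewrite mul1n; clear.
  move: (mu * N4)%N (b.+1 * N4)%N (r ^ 3)%N => u v q; lia.
have h3 : (8 * N4 * (3 * mu ^ 10) * 2 <= C * mu ^ 10)%N.
  have -> : (8 * N4 * (3 * mu ^ 10) * 2 = 8 * N4 * 6 * mu ^ 10)%N by ring.
  by rewrite leq_mul2r CN orbT.
have key : (C * mu' ^ 10 * r ^ 3 + (b.+1 * N4 + r ^ 3 + r * 5) <= C * mu ^ 10)%N.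
  move: h1 h2 h3; clear.
  move: (C * mu' ^ 10 * _)%N (_ + r * 5)%N (8 * _ * _)%N (C * mu ^ 10)%N => u v q s; lia.
move: key; rewrite -(leq_pmul2r (_ : 0 < r ^ n)%N) ?expn_gt0 ?r0 // => key.
apply: leq_trans (leq_trans _ key) _; last by rewrite mulnAC.
apply: eq_leq; rewrite -/mu'; clear; move: (mu' ^ 10)%N (r ^ 3)%N (r ^ n)%N (b.+1) => u v q s.
by ring.
Qed.

Lemma fastmul_quasilinear :
  exists C, forall n, (0 < n)%N -> fastmul n (C * n * (up_log 2 n).+1 ^ 10).
Proof.
(* In characteristic 2 the radix is 3, which equals 1 there; otherwise 2 is invertible. *)
have [r [pr r3 rF]] : exists r, [/\ prime r, (r <= 3)%N & r%:R != 0 :> F].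
  have [F2|F2] := eqVneq (2%:R : F) 0; last by exists 2%N.
  by exists 3%N; split=> //; rewrite -[3%N]/(2 + 1)%N natrD F2 add0r oner_neq0.
have [C hC] := fastmul_exp pr r3 rF.
(* Rounding [n] up to a power of [r] costs at most a factor [r]. *)
exists (C * r)%N => n n0; have r1 := prime_gt1 pr.
apply: fastmul_leq (hC (up_log r n)); first by rewrite up_logP.
rewrite -!mulnA leq_mul2l; apply/orP; right; rewrite mulnA.
apply: leq_mul.
  case: n n0 => [//|[|n]] _; first by rewrite up_log1 muln1 prime_gt0.
  have /andP[lt _] := up_log_bounds r1 (isT : (1 < n.+2)%N).
  have: (0 < up_log r n.+2)%N by rewrite up_log_gt0 r1.
  by case: (up_log r n.+2) lt => // k /= lt _; rewrite expnS leq_mul2l ltnW ?orbT.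
rewrite leq_exp2r // ltnS; apply: leq_trans (leq_subr _ _) _.
apply: up_log_min => //; apply: leq_trans (up_logP n (isT : (1 < 2)%N)) _.
by case: (up_log 2 n) => // k; rewrite leq_exp2r.
Qed.

End FastMultiplication.

(** * Linear recurrences *)

Section LinearRecurrence.
Variable F : fieldType.
Implicit Types f g h e : nat -> F.

Definition trunc (n : nat) f k : F := if (k < n)%N then f k else 0.

Lemma vanishes_trunc n f : vanishes n (trunc n f).
Proof. by move=> k; rewrite /trunc ltnNge => ->. Qed.

Lemma eq_convolution f f' g g' k :
    (forall i, (i <= k)%N -> f i = f' i) -> (forall i, (i <= k)%N -> g i = g' i) ->
  convolution f g k = convolution f' g' k.
Proof.
move=> ff gg; apply: eq_bigr => i _.
by rewrite ff -1?ltnS // gg // leq_subr.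
Qed.

Lemma convolution_trunc n f g k : (k < n)%N ->
  convolution (trunc n f) (trunc n g) k = convolution f g k.
Proof.
by move=> kn; apply: eq_convolution => i ik; rewrite /trunc (leq_ltn_trans ik).
Qed.

Lemma convolution_poly f g k n : (k < n)%N ->
  convolution f g k = ((\poly_(i < n) f i) * (\poly_(i < n) g i))`_k.
Proof.
move=> kn; rewrite coefM; apply: eq_bigr => i _; rewrite !coef_poly.
by rewrite !(leq_ltn_trans _ kn) ?leq_subr // -ltnS.
Qed.

Lemma convolutionA f g h k :
  convolution (convolution f g) h k = convolution f (convolution g h) k.
Proof.
pose P (f : nat -> F) := \poly_(i < k.+1) f i.
transitivity ((P f * P g * P h)`_k).
  rewrite coefM; apply: eq_bigr => i _; rewrite (convolution_poly _ _ (ltn_ord i)).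
  by rewrite coef_poly ltnS leq_subr.
rewrite -mulrA coefM; apply: eq_bigr => i _.
by rewrite (@convolution_poly g h _ k.+1) ?ltnS ?leq_subr // coef_poly ltn_ord.
Qed.

Lemma convolution_one f k : convolution f (fun i => (i == 0)%N%:R) k = f k.
Proof.
rewrite /convolution big_ord_recr /= subnn mulr1 big1 ?add0r // => i _.
by rewrite subn_eq0 leqNgt ltn_ord mulr0.
Qed.

(** The list of the first [n] coefficients of the power series 1 / (1 - x e(x)), each obtained from
    all the earlier ones. *)
Fixpoint recip (e : nat -> F) (n : nat) : seq F :=
  if n is n'.+1 then
    let s := recip e n' in
    rcons s (if n' is n''.+1 then \sum_(i < n') e i * s`_(n'' - i) else 1)
  else [::].

Definition recip_coef e k : F := (recip e k.+1)`_k.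

Definition one_minus e k : F := if k is k'.+1 then - e k' else 1.

Lemma size_recip e n : size (recip e n) = n.
Proof. by elim: n => //= n IH; rewrite size_rcons IH. Qed.

Lemma nth_recip e n k : (k < n)%N -> (recip e n)`_k = recip_coef e k.
Proof.
elim: n => // n IH; rewrite ltnS leq_eqVlt => /predU1P[->//|kn].
by rewrite -IH //= nth_rcons size_recip kn.
Qed.

Lemma recip_coefS e n :
  recip_coef e n.+1 = \sum_(i < n.+1) e i * recip_coef e (n - i).
Proof.
rewrite /recip_coef; set s := recip e n.+1.
have -> : recip e n.+2 = rcons s (\sum_(i < n.+1) e i * s`_(n - i)) by [].
rewrite nth_rcons size_recip ltnn eqxx; apply: eq_bigr => i _.
by rewrite (@nth_recip e n.+1) ?ltnS ?leq_subr.
Qed.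

Lemma recip_coefP e k : convolution (one_minus e) (recip_coef e) k = (k == 0)%N%:R.
Proof.
case: k => [|k]; first by rewrite /convolution big_ord_recl big_ord0 addr0 mul1r.
rewrite /convolution big_ord_recl mul1r subn0 recip_coefS -big_split big1 // => i _.
by rewrite /= subSS mulNr subrr.
Qed.

(** The quadratic method is affordable: one reciprocal serves all rows, and the preprocessing has
    quadratic time. *)
Lemma computable_recip n :
  computable (fun e => trunc n (recip_coef e)) (n * (n * 2)).
Proof.
suff H k : (k <= n)%N -> computable (fun e => trunc k (recip_coef e)) (k * (n * 2)).
  exact: H.
elim: k => [|k IH] kn.
  exact: computable_ext (computable_select (fun _ : nat => inr 0)) _ _.
pose last (z : nat + nat -> F) : F :=
  if k is k'.+1 then \sum_(i < k) z (inl (i : nat)) * z (inr (k' - i)%N) else 1.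
have clast : computable1 last (n * 2).
  rewrite /last; case: k kn {IH last} => [|k] kn.
    exact: computable_leq (computable1_const _ 1) _.
  apply: computable1_ext (computable1_sum (fun i : 'I_k.+1 => computable1_arith OpMul
    (computable1_input F (inl (i : nat))) (computable1_input F (inr (k - i)%N)))) _ _ => //.
  by rewrite card_ord leq_mul2r ltnW ?orbT.
have := computable_let id (IH (ltnW kn)) (computable_post
  (fun l => if (l < k)%N then inl (inr l) else if l == k then inr tt else inl (inr l))
  (computable_pair (computable_reindex F id) clast)).
move/computable_ext; apply; first by rewrite add0n mulSn addnC.
move=> e l /=; rewrite /trunc ltnS.
case: ltngtP => //= lk; first by rewrite lk.
  by rewrite ltnNge (ltnW lk).
rewrite /last lk; case: k {IH clast last kn lk} => // k; rewrite recip_coefS.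
by apply: eq_bigr => i _ /=; rewrite ltnS leq_subr.
Qed.

(** The two linear maps before the products, the products themselves and the last linear map cost at
    most [c] each. *)
Lemma computable_convolution (n c : nat) : fastmul F n c ->
  computable (fun z : nat + nat -> F =>
    trunc n (convolution (fun k => z (inl k)) (fun k => z (inr k)))) (4 * c).
Proof.
move=> [Rt [al [be [ga [cR [cal cbe cga] _ gaE]]]]].
have ctr (s : nat -> nat + nat) :
    computable (fun z : nat + nat -> F => trunc n (fun k => z (s k))) 0.
  have := computable_pad (fun k => if (k < n)%N then Some (s k) else None)
    (computable_reindex F id).
  by move/computable_ext; apply => // z k; rewrite /trunc; case: ifP.
have cmul : computable (fun (y : Rt + Rt -> F) i => y (inl i) * y (inr i)) c.
  apply: computable_leq (computable_fin (c := 1) _) _; last by rewrite muln1.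
  move=> i.
  exact: (computable1_arith OpMul (computable1_input F (inl i)) (computable1_input F (inr i))).
have := computable_post (fun k => if (k < n)%N then inl k else inr tt) (computable_pair
  (computable_comp (computable_comp (computable_pair
    (computable_comp (ctr inl) cal) (computable_comp (ctr inr) cbe)) cmul) cga)
  (computable1_const _ 0)).
move/computable_ext; apply; first by lia.
move=> z k /=; rewrite [RHS]/trunc; case: ifP => //= kn.
by rewrite -[RHS](convolution_trunc _ _ kn) gaE //; apply: vanishes_trunc.
Qed.

(* The generating series of w is a polynomial of degree less than n over 1 - X * e. *)
Lemma recurrence_series (n : nat) (w e : nat -> F) :
    (forall j, w (j + n)%N = \sum_(i < n) e i * w (j + (n - i.+1))%N) ->
    vanishes n e ->
  forall k, w k = convolution (trunc n (convolution w (one_minus e))) (recip_coef e) k.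
Proof.
move=> wE en k.
rewrite -[LHS](convolution_one w).
rewrite (_ : convolution w _ k
  = convolution w (convolution (one_minus e) (recip_coef e)) k); last first.
  by apply: eq_convolution => // i _; rewrite recip_coefP.
rewrite -convolutionA; apply: eq_convolution => // i _; rewrite /trunc.
(* From degree [n] on, the recurrence makes the coefficients of w (1 - x e) vanish. *)
case: ltnP => // ni; rewrite /convolution big_ord_recr /= subnn mulr1.
have wi : w i = \sum_(b < n) e b * w (i - n + (n - b.+1))%N.
  by rewrite -{1}(subnK ni) wE.
rewrite [X in _ + X]wi (reindex_inj rev_ord_inj) /=.
rewrite (eq_bigr (fun b : 'I_i => - (e b * w (i - b.+1)%N))); last first.
  by move=> b _; rewrite subKn // mulrN mulrC.
rewrite sumrN addrC; apply/eqP; rewrite subr_eq0; apply/eqP.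
rewrite (big_ord_widen _ (fun b => e b * w (i - n + (n - b.+1))%N) ni) big_mkcond.
apply: eq_bigr => b _; case: ltnP => [bn|/en ->]; last by rewrite mul0r.
by congr (_ * w _); lia.
Qed.

End LinearRecurrence.

(** * Krylov sequences and preprocessing *)

Section Krylov.
Variables (F : fieldType) (n : nat).
Implicit Types A U C : 'M[F]_n.+1.

Definition krylov U C (i : 'I_n.+1) (k : nat) : F := (U *m C ^+ k) i ord0.

Lemma companion_expr_col0 (p : {poly F}) (k : nat) (a : 'I_n.+1) : (k <= n)%N ->
  (companion n p ^+ k) a ord0 = (a == k :> nat)%:R.
Proof.
elim: k a => [|k IH] a kn; first by rewrite expr0 mxE -val_eqE.
rewrite exprS -mulmxE mxE (bigD1 (Ordinal (ltnW kn : k < n.+1)%N)) //= big1.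
  rewrite addr0 IH; last exact: ltnW.
  rewrite eqxx mulr1 mxE -val_eqE /=.
  by rewrite ltn_eqF //= kn.
by move=> b; rewrite -val_eqE /= => bk; rewrite IH; [rewrite (negPf bk) mulr0 | exact: ltnW].
Qed.

Lemma krylovE (p : {poly F}) U (i l : 'I_n.+1) (k : nat) :
  (U *m companion n p ^+ k) i l = krylov U (companion n p) i (k + l).
Proof.
rewrite /krylov exprD -mulmxE mulmxA [RHS]mxE (bigD1 l) //= big1.
  by rewrite companion_expr_col0 -1?ltnS // eqxx mulr1 addr0.
move=> b bl; rewrite companion_expr_col0 -1?ltnS //.
by rewrite val_eqE (negPf bl) mulr0.
Qed.

(** C^(n + 1) e_0 = C e_n is the last column of [C], so its entries are the coefficients of the
    recurrence; [rev_ord] puts that of the most recent term first. *)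
Lemma krylov_recurrence (p : {poly F}) U (i : 'I_n.+1) (j : nat) :
  let C := companion n p in
  krylov U C i (j + n.+1)
  = \sum_(b < n.+1) C (rev_ord b) ord_max * krylov U C i (j + (n.+1 - b.+1)).
Proof.
move=> C; rewrite /krylov exprD -mulmxE mulmxA mxE (reindex_inj rev_ord_inj) /=.
apply: eq_bigr => b _; rewrite krylovE mulrC; congr (_ * _).
rewrite exprS -mulmxE mxE (bigD1 ord_max) //= big1.
  by rewrite companion_expr_col0 //= eqxx mulr1 addr0.
move=> l; rewrite -val_eqE => ln.
by rewrite companion_expr_col0 // (negPf ln) mulr0.
Qed.

Lemma frobenius_power A U C (k : nat) (i j : 'I_n.+1) : frobenius_form A U C ->
  (A ^+ k) i j = \sum_(l < n.+1) krylov U C i (k + l) * invmx U l j.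
Proof.
move=> [Uu Ce Ae].
have Ak : A ^+ k = U *m C ^+ k *m invmx U.
  elim: k => [|k IH]; first by rewrite !expr0 mulmx1 mulmxV.
  rewrite exprS IH {1}Ae -!mulmxE exprS -mulmxE -!mulmxA; congr (_ *m (_ *m _)).
  by rewrite !mulmxA mulVmx // mul1mx.
rewrite Ak mxE Ce; apply: eq_bigr => l _; by rewrite krylovE.
Qed.

Definition fnf_recurrence (x : fnf_entry n.+1 -> F) (b : nat) : F :=
  if insub b is Some b' then x (EntryC (rev_ord b') ord_max) else 0.

Definition fnf_initial (x : fnf_entry n.+1 -> F) (i : 'I_n.+1) (k : nat) : F :=
  if insub k is Some k' then x (EntryU i k') else 0.

(** The closed form of [recurrence_series]; the initial terms are read from row [i] of [U], since U
    C^k e_0 = U e_k for k <= n. *)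
Definition fnf_krylov (x : fnf_entry n.+1 -> F) (i : 'I_n.+1) : nat -> F :=
  convolution
    (trunc n.+1 (convolution (fnf_initial x i) (one_minus (fnf_recurrence x))))
    (recip_coef (fnf_recurrence x)).

Lemma fnf_krylovE (p : {poly F}) A U (i : 'I_n.+1) (k : nat) :
  fnf_krylov (fnf_input A U (companion n p)) i k = krylov U (companion n p) i k.
Proof.
set C := companion n p; set x := fnf_input A U C.
rewrite [RHS](@recurrence_series F n.+1 _ (fnf_recurrence x)); last 2 first.
- move=> j; rewrite krylov_recurrence; apply: eq_bigr => b _.
  by rewrite /fnf_recurrence valK.
- move=> l nl; rewrite /fnf_recurrence insubF //.
  by apply/negbTE; rewrite -leqNgt.
apply: eq_convolution => // l _; rewrite /trunc; case: ltnP => // ln.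
apply: eq_convolution => // m ml; have mn := leq_ltn_trans ml ln.
have := krylovE p U i (Ordinal mn) 0; rewrite expr0 mulmx1 add0n => <-.
by rewrite /fnf_initial insubT.
Qed.

(** A query needs Krylov terms of index at most h + n, and h <= n + 1, hence 2 (n + 1) terms in each
    row; the inverse of [U] is passed on unchanged. *)
Definition fnf_pre (x : fnf_entry n.+1 -> F)
    (o : 'I_n.+1 * 'I_(n.+1 + n.+1) + 'I_n.+1 * 'I_n.+1) : F :=
  match o with
  | inl ik => fnf_krylov x ik.1 ik.2
  | inr lj => x (EntryUinv lj.1 lj.2)
  end.

(** Every row takes two truncated products at [4 * c]. The shared reciprocal, of 2 n + 2 terms,
    takes 8 (n + 1)^2 operations, and the negations fit into the rest of the second summand. *)
Lemma computable_fnf_pre (c : nat) : fastmul F (n.+1 + n.+1) c ->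
  computable fnf_pre (n.+1 * (8 * c) + 10 * (n.+1 * n.+1)).
Proof.
move=> fm; pose N2 := (n.+1 + n.+1)%N.
have crec : computable fnf_recurrence 0.
  have := computable_pad (fun b => if insub b is Some b'
    then Some (EntryC (rev_ord (b' : 'I_n.+1)) ord_max) else None)
    (computable_reindex F id).
  by move/computable_ext; apply=> // x b; rewrite /fnf_recurrence; case: insub.
have cone : computable (fun x => trunc N2 (one_minus (fnf_recurrence x))) (N2 * 1).
  apply: (computable_nat (g := fun x => one_minus (fnf_recurrence x))) => -[|k] _ /=.
    exact: computable_leq (computable1_const _ _) _.
  apply: computable1_ext (computable1_arith OpSub (computable1_const _ 0)
    (computable1_at k crec)) _ _ => // x /=; exact: sub0r.
have crecip := computable_comp crec (computable_recip F N2).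
pose E := fnf_entry n.+1.
pose L : Type := (E + (nat + nat))%type.
pose u i (y : L -> F) := fnf_initial (fun e => y (inl e)) i.
have cu i : computable (u i) 0.
  have := computable_pad (fun b => if insub b is Some b'
    then Some (inl (EntryU i (b' : 'I_n.+1)) : L) else None) (computable_reindex F id).
  by move/computable_ext; apply=> // x b; rewrite /u /fnf_initial; case: insub.
have crow i : computable (fun y : L -> F => trunc N2 (convolution
      (trunc n.+1 (trunc N2 (convolution (u i y) (fun k => y (inr (inl k))))))
      (fun k => y (inr (inr k))))) (8 * c).
  have c1 := computable_comp (computable_pair (cu i)
     (computable_reindex F (fun k : nat => inr (inl k) : L))) (computable_convolution fm).
  have c2 := computable_pad (fun k => if (k < n.+1)%N then Some k else None) c1.
  have := computable_comp (computable_pair c2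
    (computable_reindex F (fun k : nat => inr (inr k) : L))) (computable_convolution fm).
  move/computable_ext; apply; first by lia.
  move=> y k; rewrite /trunc; case: ifP => // _; apply: eq_convolution => // l _ /=.
  by rewrite /trunc; case: ifP.
have call := computable_let id (computable_pair cone crecip)
  (computable_pair (computable_family_fin crow)
     (computable_reindex F (inl : E -> L))).
have := computable_post (fun o : 'I_n.+1 * 'I_N2 + 'I_n.+1 * 'I_n.+1 =>
  match o with inl ik => inl (ik.1, ik.2 : nat) | inr lj => inr (EntryUinv lj.1 lj.2) end) call.
move/computable_ext; apply.
  by rewrite card_ord /N2; lia.
move=> x [[i k]|[l j]] //=.
rewrite {1}/trunc ltn_ord; apply: eq_convolution => m mk; last first.
  by rewrite /trunc (leq_ltn_trans mk).
rewrite /trunc; case: ifP => // mn; rewrite ltn_addr //.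
apply: eq_convolution => // l lm; rewrite ltn_addr //; exact: leq_ltn_trans mn.
Qed.

End Krylov.

(** * Middle products *)

Section MiddleProduct.
Variable F : fieldType.

(** A window of length 2 h that starts at index b h + 1, as the powers of [A] start with A^1. Its
    partner [block_right] is reversed, which turns the correlation into a convolution. *)
Definition block_left (h b : nat) (w : nat -> F) : nat -> F :=
  trunc (h + h) (fun u => w (b * h + u).+1).

Definition block_right (h b : nat) (v : nat -> F) : nat -> F :=
  trunc h (fun u => v (b * h + (h - u.+1))%N).

(** In coefficient k + h - 1, the reversal pairs entries of [w] and [v] whose indices differ by k +
    1; all of them lie within the window of length 2 h. *)
Lemma convolution_block (h b : nat) (w v : nat -> F) (k : nat) : (k < h)%N ->
  convolution (block_left h b w) (block_right h b v) (k + h).-1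
  = \sum_(l < h) w (k + (h * b + l)).+1 * v (h * b + l)%N.
Proof.
move=> kh; have kh1 : ((k + h).-1.+1 = k + h)%N by lia.
rewrite /convolution kh1 (reindex_inj rev_ord_inj) /=.
rewrite [RHS](reindex_inj rev_ord_inj) /=.
rewrite (big_ord_widen _ (fun l => w (k + (h * b + (h - l.+1))).+1 * v (h * b + (h - l.+1))%N)
  (leq_addl k h)) [RHS]big_mkcond /=; apply: eq_bigr => l _.
have -> : ((k + h).-1 - (k + h - l.+1) = l)%N by have := ltn_ord l; lia.
rewrite /block_right /block_left /trunc; case: (ltnP l h) => lh; last by rewrite mulr0.
rewrite ifT; last by lia.
by congr (w _ * v _); lia.
Qed.

(** The blocks come in [g] groups of [q]: rounding n^(1 - alpha) and n^alpha down may leave q h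
    below [N], and a constant [g] makes up for it. The sequence [v] is padded by zeros. *)
Lemma middle_product_blocks (N g q h : nat) (w v : nat -> F) (k : nat) :
    (k < h)%N -> (N <= g * q * h)%N ->
  \sum_(l < N) w (k + l).+1 * v l
  = \sum_(b : 'I_g * 'I_q) convolution (block_left h (b.1 * q + b.2) w)
      (block_right h (b.1 * q + b.2) (trunc N v)) (k + h).-1.
Proof.
move=> kh NB; rewrite (big_ord_widen _ (fun l => w (k + l).+1 * v l) NB) big_mkcond /=.
pose G l := w (k + l).+1 * trunc N v l.
transitivity (\sum_(l < g * q * h) G l).
  by apply: eq_bigr => l _; rewrite /G /trunc; case: ifP; rewrite ?mulr0.
rewrite mulnC sum_mul_ord exchange_big /=.
rewrite -(pair_bigA _ (fun b1 b2 => convolution (block_left h ((b1 : 'I_g) * q + (b2 : 'I_q)) w)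
  (block_right h (b1 * q + b2) (trunc N v)) (k + h).-1)) /=.
rewrite [(g * q)%N]mulnC (sum_mul_ord _ _ (fun b => \sum_(l < h) G (h * b + l)%N)).
rewrite exchange_big; apply: eq_bigr => b1 _; apply: eq_bigr => b2 _.
by rewrite convolution_block // [(b1 * q)%N]mulnC.
Qed.

(** Allows the last linear map to be applied once to the sum of the products over all blocks, rather
    than block by block. *)
Lemma additive_sum (Rt : Type) (J : Type) (s : seq J) (ga : (Rt -> F) -> nat -> F)
    (u : J -> Rt -> F) k :
    (forall u v k, ga (fun i => u i + v i) k = ga u k + ga v k) ->
  ga (fun i => \sum_(j <- s) u j i) k = \sum_(j <- s) ga (u j) k.
Proof.
move=> gaD; elim: s => [|j s IH].
  rewrite big_nil; have := gaD (fun=> 0) (fun=> 0) k.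
  rewrite (_ : (fun i => 0 + 0) = (fun=> 0)); last by apply: funext => i; rewrite addr0.
  rewrite (_ : (fun i => \sum_(j <- [::]) u j i) = (fun=> 0)); last first.
    by apply: funext => i; rewrite big_nil.
  by rewrite -{1}[ga _ k]addr0 => /addrI.
rewrite big_cons -IH -gaD; congr (ga _ k); apply: funext => i.
by rewrite big_cons.
Qed.

Definition matrix_product (X B Y : finType) (z : X * B + B * Y -> F) (o : X * Y) : F :=
  \sum_b z (inl (o.1, b)) * z (inr (b, o.2)).

Definition middle_product (N h : nat) (X Y : Type) (z : X * nat + nat * Y -> F)
    (o : X * Y * 'I_h) : F :=
  \sum_(l < N) z (inl (o.1.1, (o.2 + l).+1)) * z (inr (l : nat, o.1.2)).

(** The linear maps act on every block of every row and column. For each of the at most [c] products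
    of scalars and each group, one matrix product then sums over the [q] blocks of the group; the
    groups are added up before the final linear map is applied for each pair in X * Y. *)
Lemma computable_middle_product (X Y : finType) (N g q h c cm : nat) :
    fastmul F (h + h) c -> computable (@matrix_product X 'I_q Y) cm ->
    (N <= g * q * h)%N ->
  computable (@middle_product N h X Y)
    (#|X| * (g * q) * c + #|Y| * (g * q) * c + c * g * cm
     + #|X| * #|Y| * c * g + #|X| * #|Y| * c).
Proof.
move=> [Rt [al [be [ga [cR [cal cbe cga] gaD gaE]]]]] cmm NB.
pose I : Type := (X * nat + nat * Y)%type.
pose wl (z : I -> F) x l := z (inl (x, l)).
pose vl (z : I -> F) y l := z (inr (l, y)).
pose blk (b : 'I_g * 'I_q) := (b.1 * q + b.2)%N.
have cl : computable (fun (z : I -> F) (e : X * ('I_g * 'I_q) * Rt) =>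
    al (block_left h (blk e.1.2) (wl z e.1.1)) e.2) (#|X| * (g * q) * c).
  have := computable_family_fin (fun e : X * ('I_g * 'I_q) => computable_comp
    (computable_pad (fun u => if (u < h + h)%N then Some (inl (e.1, (blk e.2 * h + u).+1) : I)
       else None) (computable_reindex F id)) cal).
  move/computable_ext; apply; first by rewrite !card_prod !card_ord.
  move=> z [e s] /=; congr (al _ s); apply: funext => u.
  by rewrite /block_left /trunc; case: ifP.
have cr : computable (fun (z : I -> F) (e : Y * ('I_g * 'I_q) * Rt) =>
    be (block_right h (blk e.1.2) (trunc N (vl z e.1.1))) e.2) (#|Y| * (g * q) * c).
  have := computable_family_fin (fun e : Y * ('I_g * 'I_q) => computable_comp
    (computable_pad (fun u => if (u < h)%N && (blk e.2 * h + (h - u.+1) < N)%N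
       then Some (inr ((blk e.2 * h + (h - u.+1))%N, e.1) : I)
       else None) (computable_reindex F id)) cbe).
  move/computable_ext; apply; first by rewrite !card_prod !card_ord.
  move=> z [e s] /=; congr (be _ s); apply: funext => u.
  by rewrite /block_right /trunc; case: ltnP => //= uh; case: ifP.
have cp := computable_comp (computable_pair cl cr)
  (computable_family_fin (fun sb : Rt * 'I_g => computable_pre
    (fun e : X * 'I_q + 'I_q * Y => match e with
       | inl xb => inl (xb.1, (sb.2, xb.2), sb.1)
       | inr bY => inr (bY.2, (sb.2, bY.1), sb.1) end) cmm)).
have cs := computable_comp cp (computable_fin
  (g := fun y (e : X * Y * Rt) => \sum_(b < g) y ((e.2, b), e.1)) (c := g) _).
have := computable_comp (cs _) (computable_family_fin
  (fun xy : X * Y => computable_pre (fun s => (xy, s)) cga)).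
move=> /(_ _)/(computable_post (fun o : X * Y * 'I_h => (o.1, (o.2 + h).-1))) /computable_ext.
apply.
- move=> e; apply: computable1_ext (computable1_sum (fun b : 'I_g =>
    computable1_input F ((e.2, b), e.1))) _ _ => //.
  by rewrite card_ord muln1.
- rewrite !card_prod card_ord leq_add2r -!addnA !leq_add2l.
  by rewrite leq_add // ?leq_mul // -[(_ * c * g)%N]mulnA -mulnA leq_mul // leq_mul.
move=> z [[x y] k] /=.
rewrite /middle_product /= (middle_product_blocks (wl z x) (vl z y) (ltn_ord k) NB).
under eq_bigr => b _.
  rewrite gaE; last 2 first.
  - exact: vanishes_trunc.
  - by move=> l hl; apply: vanishes_trunc; apply: leq_trans hl; apply: leq_addr.
  over.
rewrite -(additive_sum (index_enum _) (fun (b : 'I_g * 'I_q) s =>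
  al (block_left h (blk b) (wl z x)) s * be (block_right h (blk b) (trunc N (vl z y))) s)) //.
congr (ga _ _); apply: funext => s.
by rewrite /matrix_product pair_bigA.
Qed.

End MiddleProduct.

(** * Matrix multiplication programs and queries *)

Section MatrixProgram.
Variables (F : fieldType) (p q r : nat).
Variable P : slp F ('I_p * 'I_q + 'I_q * 'I_r) ('I_p * 'I_r).
Hypothesis PP : computes_mm P.
Hypotheses (p0 : (0 < p)%N) (q0 : (0 < q)%N) (r0 : (0 < r)%N).

Definition operand_inputs (I : Type) (o : operand F I) : seq I :=
  if o is Input i then [:: i] else [::].

Definition instr_inputs (I : Type) (ins : arith * operand F I * operand F I) : seq I :=
  let: (_, a, b) := ins in operand_inputs a ++ operand_inputs b.

Lemma foldl_step_eq (I : eqType) (x y : I -> F) mem code :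
    (forall i, i \in flatten (map (@instr_inputs I) code) -> x i = y i) ->
  foldl (slp_step x) mem code = foldl (slp_step y) mem code.
Proof.
elim: code mem => // [[[op a] b] code] IH mem xy /=.
have oE o : {subset operand_inputs o <= operand_inputs a ++ operand_inputs b} ->
    operand_eval x mem o = operand_eval y mem o.
  case: o => //= i si; apply: xy; rewrite /= mem_cat si //; exact: mem_head.
rewrite !oE; first last.
- by move=> i ia; rewrite mem_cat ia.
- by move=> i ib; rewrite mem_cat ib orbT.
by apply: IH => i ic; apply: xy; rewrite /= mem_cat ic orbT.
Qed.

Lemma size_inputs (I : Type) (code : seq (arith * operand F I * operand F I)) :
  (size (flatten (map (@instr_inputs I) code)) <= 2 * size code)%N.
Proof.
elim: code => //= [[[op a] b] code] IH; rewrite size_cat mulnS leq_add //= size_cat.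
by case: a => [?|?|?]; case: b => [?|?|?].
Qed.

(** An input, a constant or a missing result cannot be zero whenever one factor is zero and still be
    one on a product of matrix units. *)
Lemma mm_out_tmp i k : exists2 l, slp_out P (i, k) = Tmp F _ l & (l < slp_cost P)%N.
Proof.
have H0 A : slp_eval P (mm_input A 0) (i, k) = 0 by rewrite PP mulmx0 mxE.
have H0' B : slp_eval P (mm_input 0 B) (i, k) = 0 by rewrite PP mul0mx mxE.
pose j := Ordinal q0.
have H1 : slp_eval P (mm_input (delta_mx i j) (delta_mx j k)) (i, k) = 1.
  by rewrite PP mul_delta_mx mxE !eqxx.
move: H0 H0' H1; rewrite /slp_eval; case: (slp_out P (i, k)) => [[[a b]|[a b]]|c|l] /=.
- by move=> /(_ (delta_mx a b)); rewrite mxE !eqxx => /eqP; rewrite oner_eq0.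
- by move=> _ /(_ (delta_mx a b)); rewrite mxE !eqxx => /eqP; rewrite oner_eq0.
- by move=> /(_ 0) -> _ /esym/eqP; rewrite oner_eq0.
- move=> _ _ H; exists l => //; rewrite ltnNge; apply/negP => Pl.
  move: H; rewrite nth_default; first by move/esym/eqP; rewrite oner_eq0.
  by rewrite size_foldl_step.
Qed.

(** Different outputs are different functions of the matrices, as matrix units show, so they are
    results of different instructions. *)
Lemma mm_cost_output : (p * r <= slp_cost P)%N.
Proof.
pose idx ik := if slp_out P ik is Tmp l then l else 0%N.
have -> : (p * r = size (map idx (enum {: 'I_p * 'I_r})))%N.
  by rewrite size_map -cardE card_prod !card_ord.
rewrite -[slp_cost P](size_iota 0); apply: uniq_leq_size; last first.
  move=> l /mapP[[i k] _ ->]; rewrite mem_iota /= add0n /idx.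
  by have [l' -> ] := mm_out_tmp i k.
rewrite map_inj_uniq ?enum_uniq // => -[i k] [i' k'].
rewrite /idx; have [l e _] := mm_out_tmp i k; have [l' e' _] := mm_out_tmp i' k'.
rewrite e e' => ll; rewrite -{}ll in e'.
pose j := Ordinal q0.
have := PP (delta_mx i j) (delta_mx j k) i' k'.
rewrite /slp_eval e' -e -[operand_eval _ _ _]/(slp_eval P _ (i, k)) PP.
rewrite mul_delta_mx !mxE !eqxx /=; case: eqP => [->|_]; case: eqP => [->|_] //=;
  by move/eqP; rewrite oner_eq0.
Qed.

(** Every entry of the left factor has to be read, since setting it to zero can change the product,
    and an instruction reads at most two inputs. *)
Lemma mm_cost_left : (p * q <= 2 * slp_cost P)%N.
Proof.
apply: leq_trans (size_inputs (slp_code P)).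
have -> : (p * q = size [seq inl ij : 'I_p * 'I_q + 'I_q * 'I_r | ij <- enum {: 'I_p * 'I_q}])%N.
  by rewrite size_map -cardE card_prod !card_ord.
apply: uniq_leq_size; first by rewrite map_inj_uniq ?enum_uniq // => ? ? [].
move=> _ /mapP[[i j] _ ->]; apply: contraT => nin.
pose k := Ordinal r0; have [l e _] := mm_out_tmp i k.
have E : slp_eval P (mm_input (delta_mx i j) (delta_mx j k)) (i, k)
    = slp_eval P (mm_input 0 (delta_mx j k)) (i, k).
  rewrite /slp_eval e /=; congr (nth 0 _ _); apply: foldl_step_eq => -[[a b]|//] ab /=.
  rewrite !mxE; case: eqP => [ai|//]; case: eqP => [bj|//].
  by rewrite -ai -bj ab in nin.
move: E; rewrite !PP mul_delta_mx mul0mx !mxE !eqxx /= => /eqP.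
by rewrite oner_eq0.
Qed.

Lemma mm_cost_right : (q * r <= 2 * slp_cost P)%N.
Proof.
apply: leq_trans (size_inputs (slp_code P)).
have -> : (q * r = size [seq inr ij : 'I_p * 'I_q + 'I_q * 'I_r | ij <- enum {: 'I_q * 'I_r}])%N.
  by rewrite size_map -cardE card_prod !card_ord.
apply: uniq_leq_size; first by rewrite map_inj_uniq ?enum_uniq // => ? ? [].
move=> _ /mapP[[j k] _ ->]; apply: contraT => nin.
pose i := Ordinal p0; have [l e _] := mm_out_tmp i k.
have E : slp_eval P (mm_input (delta_mx i j) (delta_mx j k)) (i, k)
    = slp_eval P (mm_input (delta_mx i j) 0) (i, k).
  rewrite /slp_eval e /=; congr (nth 0 _ _); apply: foldl_step_eq => -[//|[a b]] ab /=.
  rewrite !mxE; case: eqP => [ai|//]; case: eqP => [bj|//].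
  by rewrite -ai -bj ab in nin.
move: E; rewrite !PP mul_delta_mx mulmx0 !mxE !eqxx /= => /eqP.
by rewrite oner_eq0.
Qed.

Lemma computable_matrix_product (X Y : finType) : #|X| = p -> #|Y| = r ->
  computable (@matrix_product F X 'I_q Y) (slp_cost P).
Proof.
move=> eX eY; move: P PP; rewrite -eX -eY => P' PP'.
have cP : computable (slp_eval P') (slp_cost P') by exists P'.
have := computable_post (fun o : X * Y => (enum_rank o.1, enum_rank o.2))
  (computable_pre (fun e : 'I_#|X| * 'I_q + 'I_q * 'I_#|Y| => match e with
     | inl ij => inl (enum_val ij.1, ij.2)
     | inr jk => inr (jk.1, enum_val jk.2) end : X * 'I_q + 'I_q * Y) cP).
move/computable_ext; apply=> // z [x y] /=.
rewrite (_ : (fun e => _) = mm_input (\matrix_(i, b) z (inl (enum_val i, b)))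
                                     (\matrix_(b, j) z (inr (b, enum_val j)))).
  by rewrite PP' mxE; apply: eq_bigr => b _; rewrite !mxE !enum_rankK.
by apply: funext => -[[i b]|[b j]] /=; rewrite mxE.
Qed.

End MatrixProgram.

(** * Queries on the preprocessed data *)

Section Query.
Variables (F : fieldType) (n : nat) (S T : {set 'I_n.+1}) (h : nat).

Let O : finType := ('I_n.+1 * 'I_(n.+1 + n.+1) + 'I_n.+1 * 'I_n.+1)%type.
Let X : finType := {i : 'I_n.+1 | i \in S}.
Let Y : finType := {j : 'I_n.+1 | j \in T}.

(** Decodes the results of the preprocessing, which are stored under the rank of their index in [O];
    positions out of range read as zero. *)
Definition query_data (y : 'I_#|O| -> F) (e : X * nat + nat * Y) : F :=
  match e with
  | inl (i, l) => if insub l is Some l' then y (enum_rank (inl (val i, l') : O)) else 0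
  | inr (l, j) => if insub l is Some l' then y (enum_rank (inr (l', val j) : O)) else 0
  end.

Definition query (y : 'I_#|O| -> F) : X * Y * 'I_h -> F :=
  middle_product n.+1 (query_data y).

Lemma computable_query_data : computable query_data 0.
Proof.
have := computable_pad (fun e : X * nat + nat * Y => match e with
  | inl (i, l) => if insub l is Some l' then Some (enum_rank (inl (val i, l') : O)) else None
  | inr (l, j) => if insub l is Some l' then Some (enum_rank (inr (l', val j) : O)) else None
  end) (computable_reindex F id).
by move/computable_ext; apply=> // x [[i l]|[l j]] /=; case: insub.
Qed.

(** Serves to know that some program exists for all [S], [T] and [h], so that a cheapest one can be
    chosen. *)
Lemma computable_query_naive : exists c, computable query c.
Proof.
exists (0 + #|{: X * Y * 'I_h}| * (#|'I_n.+1| * 2))%N; rewrite /query.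
apply: (computable_comp computable_query_data (g := @middle_product F n.+1 h X Y)).
apply: computable_fin => o; apply: computable1_sum => l.
exact: (computable1_arith OpMul (computable1_input _ _) (computable1_input _ _)).
Qed.

Lemma queryE (x : fnf_entry n.+1 -> F) (i : X) (j : Y) (k : 'I_h) :
    (h <= n.+1)%N ->
  query (fun o => fnf_pre x (enum_val o)) (i, j, k)
  = \sum_(l < n.+1) fnf_krylov x (val i) (k.+1 + l) * x (EntryUinv l (val j)).
Proof.
move=> hn; apply: eq_bigr => l _ /=; rewrite valK enum_rankK /=; congr (_ * _).
have kl : ((k + l).+1 < n.+1 + n.+1)%N.
  by have := ltn_ord k; have := ltn_ord l; lia.
by rewrite insubT enum_rankK.
Qed.

Lemma card_setsub (A : {set 'I_n.+1}) : #|{: {i | i \in A}}| = #|A|.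
Proof. by rewrite card_sig; apply: eq_card => i; rewrite inE. Qed.

(** Four groups of blocks are used. By the lower bounds on [slp_cost P], the linear maps cost at
    most a constant multiple of the matrix products: 25 = 4 * 2 + 4 * 2 + 4 + 5. *)
Lemma computable_query (q c : nat)
    (P : slp F ('I_#|S| * 'I_q + 'I_q * 'I_#|T|) ('I_#|S| * 'I_#|T|)) :
    computes_mm P -> (0 < #|S|)%N -> (0 < q)%N -> (0 < #|T|)%N ->
    fastmul F (h + h) c -> (n.+1 <= 4 * q * h)%N ->
  computable query (25 * (c * slp_cost P)).
Proof.
move=> PP S0 q0 T0 fm nq.
have cS := card_setsub S; have cT := card_setsub T.
have := computable_comp computable_query_data
  (computable_middle_product fm (computable_matrix_product PP cS cT) nq).
move/computable_leq; apply; rewrite cS cT.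
have h1 := mm_cost_left PP q0 T0; have h2 := mm_cost_right PP S0 q0.
have h3 := mm_cost_output PP q0.
have h1' := leq_mul (leqnn c) h1; have h2' := leq_mul (leqnn c) h2.
have h3' := leq_mul (leqnn c) h3.
rewrite add0n.
have -> : (#|S| * (4 * q) * c + #|T| * (4 * q) * c + c * 4 * slp_cost P
   + #|S| * #|T| * c * 4 + #|S| * #|T| * c
   = 4 * (c * (#|S| * q)) + 4 * (c * (q * #|T|)) + 4 * (c * slp_cost P)
     + 5 * (c * (#|S| * #|T|)))%N by ring.
move: h1' h2' h3'; rewrite ![(c * (2 * _))%N]mulnCA; clear.
move: (c * slp_cost P)%N (c * (#|S| * q))%N (c * (q * #|T|))%N (c * (#|S| * #|T|))%N.
by move=> u v w z; lia.
Qed.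

End Query.

(** A cheapest program meets all cost bounds for [f] at once, which frees the choice of the program
    from the parameters of the bounds. *)
Lemma computable_min (F : fieldType) (I J : Type) (f : (I -> F) -> J -> F) :
    (exists c, computable f c) ->
  exists P : slp F I J, (forall x, slp_eval P x =1 f x)
    /\ forall c, computable f c -> (slp_cost P <= c)%N.
Proof.
move=> fc; have ex : exists c, `[< computable f c >].
  by have [c /asboolP cf] := fc; exists c.
case: (ex_minnP ex) => c /asboolP[P cP PE] cmin; exists P; split=> // c' /asboolP cf.
exact: leq_trans cP (cmin _ cf).
Qed.

(** * Asymptotic bounds *)

Section Asymptotics.
Variable R : realType.

Lemma floor_pow_gt0 (n : nat) (a : R) : (0 < n)%N -> 0 <= a -> (0 < floor_pow n a)%N.
Proof.
move=> n0 a0; rewrite /floor_pow truncn_gt0 -[leLHS](powRr0 n%:R).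
by apply: ler_powR => //; rewrite ler1n.
Qed.

Lemma floor_pow_le (n : nat) (a : R) : (floor_pow n a)%:R <= n%:R `^ a.
Proof. by rewrite truncn_le powR_ge0. Qed.

Lemma floor_pow_leq (n : nat) (a : R) : (0 < n)%N -> a <= 1 -> (floor_pow n a <= n)%N.
Proof.
move=> n0 a1; rewrite -(ler_nat R); apply: le_trans (floor_pow_le _ _) _.
by rewrite -[leRHS]powRr1 // ler_powR // ler1n.
Qed.

(** A real number x >= 1 is less than twice its integer part; this loses a factor 2 for each of the
    two powers. *)
Lemma leq_floor_pow_mul (n : nat) (a : R) : (0 < n)%N -> 0 <= a <= 1 ->
  (n <= 4 * floor_pow n (1 - a) * floor_pow n a)%N.
Proof.
move=> n0 /andP[a0 a1]; have a1' : 0 <= 1 - a by rewrite subr_ge0.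
have H b : 0 <= b -> (n%:R : R) `^ b <= 2 * (floor_pow n b)%:R.
  move=> b0; have := truncnS_gt ((n%:R : R) `^ b) => /ltW /le_trans; apply.
  rewrite -[2]/(2%:R) -natrM ler_nat -/(floor_pow n b).
  by have := floor_pow_gt0 n0 b0; lia.
rewrite -(ler_nat R) -[n%:R in leLHS]powRr1 // -[X in _ `^ X](subrK a 1).
rewrite powRD; last by rewrite pnatr_eq0 -lt0n n0 implybT.
apply: le_trans (ler_pM (powR_ge0 _ _) (powR_ge0 _ _) (H _ a1') (H _ a0)) _.
by rewrite !natrM le_eqVlt; apply/orP; left; apply/eqP; ring.
Qed.

Lemma one_leD_ln (n : nat) : (0 < n)%N -> 1 <= 1 + ln (n%:R : R).
Proof. by move=> n0; rewrite lerDl ln_ge0 // ler1n. Qed.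

Lemma up_log_ln : exists2 D : R, 0 <= D & forall n : nat, (0 < n)%N ->
  (up_log 2 n).+2%:R <= D * (1 + ln (n%:R : R)).
Proof.
have l2 : 0 < ln (2 : R) by rewrite ln_gt0 // ltr1n.
exists (3 + (ln 2)^-1) => [|n n0]; first by rewrite addr_ge0 // invr_ge0 ltW.
have L0 : 0 <= ln (n%:R : R) by rewrite ln_ge0 // ler1n.
suff : (up_log 2 n)%:R <= 1 + (ln 2)^-1 * ln (n%:R : R).
  rewrite -[(up_log 2 n).+2]addn2 natrD => u; rewrite mulrDl !mulrDr !mulr1.
  have : 0 <= (ln (2 : R))^-1 by rewrite invr_ge0 ltW.
  lra.
case: (ltnP 1 n) => n1; last first.
  have -> : n = 1%N by lia.
  by rewrite up_log1 ln1 mulr0 addr0.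
have /andP[lt _] := up_log_bounds (isT : (1 < 2)%N) n1.
have u0 : (0 < up_log 2 n)%N by rewrite up_log_gt0 n1.
rewrite -(prednK u0) -addn1 natrD addrC lerD2l mulrC ler_pdivlMr //.
rewrite mulr_natl -lnXn // ler_ln ?posrE ?exprn_gt0 ?ltr0n //.
by rewrite -natrX ler_nat ltnW.
Qed.

(** Since 2 h <= 2 n, the binary logarithm grows by at most one; together with the increment in
    [fastmul_quasilinear] this gives the shift by two in [up_log_ln]. *)
Lemma fastmul_soft (F : fieldType) : exists2 D : R, 0 <= D &
  forall n h : nat, (0 < h)%N -> (h <= n)%N ->
  exists2 c, fastmul F (h + h) c & c%:R <= D * h%:R * (1 + ln (n%:R : R)) ^+ 10.
Proof.
have [C fm] := fastmul_quasilinear F; have [D D0 hD] := up_log_ln.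
exists ((C * 2)%:R * D ^+ 10) => [|n h h0 hn]; first by rewrite mulr_ge0 ?exprn_ge0.
have n0 := leq_trans h0 hn.
exists (C * (h + h) * (up_log 2 (h + h)).+1 ^ 10)%N; first by apply: fm; rewrite addn_gt0 h0.
have e : (up_log 2 (h + h) <= (up_log 2 n).+1)%N.
  apply: up_log_min => //; rewrite expnS addnn -mul2n leq_mul2l /=.
  by apply: leq_trans hn _; apply: up_logP.
apply: (@le_trans _ _ ((C * (h + h) * (up_log 2 n).+2 ^ 10)%N%:R)).
  by rewrite ler_nat leq_mul2l leq_exp2r // ltnS e orbT.
have -> : (C * 2)%:R * D ^+ 10 * h%:R * (1 + ln (n%:R : R)) ^+ 10
    = (C * (h + h))%:R * (D * (1 + ln n%:R)) ^+ 10.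
  by rewrite addnn -mul2n mulnA [(_ * h)%:R]natrM exprMn; ring.
rewrite natrM natrX ler_wpM2l // lerXn2r ?nnegrE ?hD //.
by rewrite mulr_ge0 // (le_trans _ (one_leD_ln n0)).
Qed.

Lemma pre_soft (F : fieldType) : exists K : R, forall n : nat,
  exists2 c, computable (@fnf_pre F n) c & c%:R <= soft_bound K 10 2 n.+1.
Proof.
have [D D0 fm] := fastmul_soft F.
exists (8 * D + 10) => n; have [c cf cle] := fm n.+1 n.+1 isT (leqnn _).
exists (n.+1 * (8 * c) + 10 * (n.+1 * n.+1))%N; first exact: computable_fnf_pre.
rewrite /soft_bound powR_mulrn // expr2.
set L := (1 + _) ^+ 10 in cle *.
have L1 : 1 <= L by apply/exprn_ege1/one_leD_ln.
set N := n.+1 in cle *.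
have h1 : N%:R * c%:R * 8 <= N%:R * (D * N%:R * L) * 8 :> R.
  by rewrite ler_wpM2r // ler_wpM2l.
(* As [1 <= L], the logarithmic factor may also be put on the summand that lacks one. *)
have h2 : N%:R * N%:R * 10 * 1 <= N%:R * N%:R * 10 * L :> R.
  by rewrite ler_wpM2l ?mulr_ge0.
rewrite natrD !natrM.
apply: le_trans (_ : _ <= N%:R * (D * N%:R * L) * 8 + N%:R * N%:R * 10 * L) _.
  by apply: le_trans (lerD h1 h2); rewrite le_eqVlt; apply/orP; left; apply/eqP; ring.
by rewrite le_eqVlt; apply/orP; left; apply/eqP; ring.
Qed.

(** A query is dominated by O~(n^alpha) matrix products; [fastmul_soft] bounds their number and
    [homega] the cost of each. *)
Lemma query_soft (F : fieldType) (omega : R -> R -> R -> R) (s t alpha : R) :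
    mm_exponent F omega ->
    0 <= s <= 1 -> 0 <= t <= 1 -> 0 <= alpha <= 1 ->
  exists K : R, forall (n : nat) (S T : {set 'I_n.+1}) (h : nat),
    #|S| = floor_pow n.+1 s -> #|T| = floor_pow n.+1 t ->
    h = floor_pow n.+1 alpha ->
    exists2 c, computable (@query F n S T h) c
             & c%:R <= soft_bound K 10 (omega s (1 - alpha) t + alpha) n.+1.
Proof.
move=> homega /andP[s0 _] /andP[t0 _] a01; have /andP[a0 a1] := a01.
have a1' : 0 <= 1 - alpha by rewrite subr_ge0.
have [K hK] := homega s (1 - alpha) t s0 a1' t0.
have [D D0 fm] := fastmul_soft F.
exists (25 * D * K) => n S T h Ss Tt hh.
have [P [PP]] := hK n.+1 isT.
have S0 := floor_pow_gt0 (ltn0Sn n) s0; have T0 := floor_pow_gt0 (ltn0Sn n) t0.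
have q0 := floor_pow_gt0 (ltn0Sn n) a1'; have h0 := floor_pow_gt0 (ltn0Sn n) a0.
have nq := leq_floor_pow_mul (ltn0Sn n) a01.
have hn := floor_pow_leq (ltn0Sn n) a1; have hle := floor_pow_le n.+1 alpha.
rewrite -hh in h0 nq hn hle; rewrite -Ss in S0; rewrite -Tt in T0.
(* The type of [P] mentions the rounded powers; rewriting them as cardinalities lets [P] multiply
   matrices indexed by [S] and [T]. *)
move: P PP; rewrite -Ss -Tt => P PP cP.
have [c cf cle] := fm n.+1 h h0 hn.
exists (25 * (c * slp_cost P))%N; first exact: computable_query PP S0 q0 T0 cf nq.
rewrite /soft_bound powRD; last by rewrite pnatr_eq0 implybT.
rewrite !natrM; set L := (1 + _) ^+ 10 in cle *.
have L0 : 0 <= L by rewrite exprn_ge0 // (le_trans _ (one_leD_ln (ltn0Sn n))).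
have hc : c%:R <= D * n.+1%:R `^ alpha * L.
  by apply: le_trans cle _; rewrite ler_wpM2r // ler_wpM2l.
rewrite (_ : _ * L = 25 * (D * n.+1%:R `^ alpha * L * (K * n.+1%:R `^ omega s (1 - alpha) t))).
  by rewrite ler_wpM2l // ler_pM.
by ring.
Qed.

End Asymptotics.

(** * Choice of the programs and conclusion *)

Theorem theorem1 (R : realType) (F : finFieldType) (omega : R -> R -> R -> R)
    (homega : mm_exponent F omega) :
  exists (m : nat -> nat)
         (pre : forall n : nat, slp F (fnf_entry n.+1) 'I_(m n))
         (qry : forall (n : nat) (S T : {set 'I_n.+1}) (h : nat),
            slp F 'I_(m n)
              ({i : 'I_n.+1 | i \in S} * {j : 'I_n.+1 | j \in T} * 'I_h)),
  [/\ exists (K : R) (k : nat), forall n : nat,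
        (slp_cost (pre n))%:R <= soft_bound K k 2 n.+1,
      forall (n : nat) (A U C : 'M[F]_n.+1),
        generic A -> frobenius_form A U C ->
        forall (S T : {set 'I_n.+1}) (h : nat), (1 <= h <= n.+1)%N ->
        forall (i : {i : 'I_n.+1 | i \in S}) (j : {j : 'I_n.+1 | j \in T})
               (k : 'I_h),
          slp_eval (qry n S T h) (slp_eval (pre n) (fnf_input A U C)) (i, j, k)
          = (A ^+ k.+1) (val i) (val j)
    & forall s t alpha : R,
        0 <= s <= 1 -> 0 <= t <= 1 -> 0 <= alpha <= 1 ->
        exists (K : R) (k : nat),
        forall (n : nat) (S T : {set 'I_n.+1}) (h : nat),
          #|S| = floor_pow n.+1 s -> #|T| = floor_pow n.+1 t ->
          h = floor_pow n.+1 alpha ->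
          (slp_cost (qry n S T h))%:R
            <= soft_bound K k (omega s (1 - alpha) t + alpha) n.+1].
Proof.
pose O n : finType := ('I_n.+1 * 'I_(n.+1 + n.+1) + 'I_n.+1 * 'I_n.+1)%type.
have [K preK] := pre_soft R F.
have prec n : exists c, computable
    (fun x (o : 'I_#|O n|) => @fnf_pre F n x (enum_val o)) c.
  by have [c cf _] := preK n; exists c; apply: computable_post cf.
pose pre n := projT1 (cid (computable_min (prec n))).
have preP n := projT2 (cid (computable_min (prec n))).
(* The programs may not depend on s, t and alpha: the cheapest ones are taken. *)
pose qry n (S T : {set 'I_n.+1}) h :=
  projT1 (cid (computable_min (computable_query_naive F S T h))).
have qryP n (S T : {set 'I_n.+1}) h :=
  projT2 (cid (computable_min (computable_query_naive F S T h))).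
exists (fun n => #|O n|), pre, qry; split.
- exists K, 10%N => n; have [c cf cle] := preK n.
  apply: le_trans cle; rewrite ler_nat; apply: (preP n).2.
  exact: computable_post cf.
- move=> n A U C _ fAUC S T h /andP[_ hn] i j k.
  rewrite (qryP n S T h).1.
  rewrite (_ : slp_eval (pre n) _ = fun o => fnf_pre (fnf_input A U C) (enum_val o)).
    (* Position [k] of the answer holds the power [k.+1]; both sides become the same sum over [l],
       with Krylov terms that agree by [fnf_krylovE]. *)
    rewrite queryE // (frobenius_power _ _ _ fAUC); apply: eq_bigr => l _.
    by have [_ -> _] := fAUC; rewrite fnf_krylovE.
  by apply: funext => o; rewrite (preP n).1.
- move=> s t alpha s01 t01 a01.
  have [K' hK'] := query_soft homega s01 t01 a01.
  exists K', 10%N => n S T h Ss Tt hh; have [c cf cle] := hK' n S T h Ss Tt hh.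
  by apply: le_trans cle; rewrite ler_nat; apply: (qryP n S T h).2.
Qed.
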